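(* Let $H\in(1/2,1)$, let $K$ be the fractional Brownian kernel with Hurst index $H$, and let $a$ be the unique minimizing function of $f$ on $L_2([0,1])$. Then there exists a random variable $\xi_a$ assuming values in $\mathfrak{G}_a=\{t\in[0,1]: g_a(t)=f(a)\}$ such that $\mathsf{P}(\xi_a\ge s)>0$ for all $s\in[0,1)$ and $$a(s)=\mathsf{E}[K(\xi_a,s)\mid \xi_a\ge s]\quad\text{for almost every } s\in[0,1].$$
   Context: For $H\in(1/2,1)$ put $\alpha=H-1/2$ and $C_\alpha=\alpha\left(\frac{(2\alpha+1)\Gamma(1-\alpha)}{\Gamma(\alpha+1)\Gamma(1-2\alpha)}\right)^{1/2}$, where $\Gamma$ is the Gamma function. The fractional Brownian kernel is $K(t,s)=C_\alpha s^{-\alpha}\int_s^t u^\alpha(u-s)^{\alpha-1}\,du$ for $0<s<t\le1$, and $K(t,s)=0$ for all other $t,s\in[0,1]$. For $x\in L_2([0,1])$ put $g_x(t)=\left(\int_0^t (K(t,s)-x(s))^2\,ds\right)^{1/2}$, $t\in[0,1]$, and $f(x)=\sup_{t\in[0,1]}g_x(t)$. The functional $f$ has exactly one minimizing function on $L_2([0,1])$ (up to a.e. equality), denoted by $a$. Here $\mathsf{E}[\,\cdot\mid\xi_a\ge s]$ is the elementary conditional expectation given the event $\{\xi_a\ge s\}$ of positive probability. *)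

(* Defs.v *)
From HB Require Import structures.
From mathcomp Require Import all_boot all_order all_algebra.
From mathcomp Require Import all_classical all_reals all_analysis.

Set Implicit Arguments.
Unset Strict Implicit.
Unset Printing Implicit Defensive.

Import Order.TTheory GRing.Theory Num.Theory.
Import numFieldNormedType.Exports.

Local Open Scope classical_set_scope.
Local Open Scope ring_scope.

(* Euler's integral; meaningful for [0 < x] (elsewhere the integral diverges
   and [Rintegral] returns a junk value). *)
Definition Gamma (R : realType) (x : R) : R :=
  Rintegral lebesgue_measure `]0, +oo[ (fun t : R => t `^ (x - 1) * expR (- t)).

Definition fbm_alpha (R : realType) (H : R) : R := H - 2^-1.

Definition fbm_C (R : realType) (H : R) : R :=
  let alpha := fbm_alpha H in
  alpha * Num.sqrt ((2 * alpha + 1) * Gamma (1 - alpha) /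
                    (Gamma (alpha + 1) * Gamma (1 - 2 * alpha))).

(* The kernel is extended by 0 outside of [0 < s < t <= 1]. For [1/2 < H] the
   singularity at [u = s] is integrable; at this single point
   [0 `^ (alpha - 1)] is 0 by convention. *)
Definition fbm_kernel (R : realType) (H t s : R) : R :=
  let alpha := fbm_alpha H in
  if [&& 0 < s, s < t & t <= 1] then
    fbm_C H * s `^ (- alpha) *
    Rintegral lebesgue_measure `[s, t]
      (fun u : R => u `^ alpha * (u - s) `^ (alpha - 1))
  else 0.

(* Elements of L_2([0,1]) are represented by functions on [R] of which only the
   restriction to [0,1] matters. *)
Definition L2_01 (R : realType) (x : R -> R) : Prop :=
  measurable_fun (`[0, 1] : set R) x /\
  (\int[lebesgue_measure]_(s in `[0%R, 1%R]) ((x s) ^+ 2)%:E < +oo)%E.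

(* Extended-real values avoid assuming finiteness of the integral and of the
   supremum; both are finite for [1/2 < H < 1] and [x] in L_2([0,1]). *)
Definition fbm_g (R : realType) (H : R) (x : R -> R) (t : R) : \bar R :=
  sqrte (\int[lebesgue_measure]_(s in `[0%R, t])
           ((fbm_kernel H t s - x s) ^+ 2)%:E)%E.

Definition fbm_f (R : realType) (H : R) (x : R -> R) : \bar R :=
  ereal_sup [set fbm_g H x t | t in `[0, 1]].

Definition fbm_minimizer (R : realType) (H : R) (a : R -> R) : Prop :=
  L2_01 a /\ forall x : R -> R, L2_01 x -> (fbm_f H a <= fbm_f H x)%E.

Definition fbm_G (R : realType) (H : R) (a : R -> R) : set R :=
  [set t | t \in `[0, 1] /\ fbm_g H a t = fbm_f H a].

(* Elementary conditional expectation given an event [A]; meaningful when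
   [P A] is positive. *)
Definition cond_expectation (d : measure_display) (T : measurableType d)
    (R : realType) (P : probability T R) (X : T -> R) (A : set T) : \bar R :=
  ('E_P[X \* \1_A] * ((fine (P A))^-1)%:E)%E.

(* Main.v *)
Require Import Defs.
From HB Require Import structures.
From mathcomp Require Import all_boot all_order all_algebra.
From mathcomp Require Import all_classical all_reals all_analysis.
From mathcomp Require Import measurable_realfun ring lra.

(** Write [r_t = 1_[0,t] (K(t,.) - x)] for the residual of [x] at time [t], a
    vector of L_2([0,1]), so that [f(x)^2] is the supremum over [t] of the
    energies [|r_t|^2], each of which is a convex quadratic function of [x].
    A time [t] is active when the energy of the minimizer [a] at [t] equals
    [f(a)^2]; the active times form the set to which the random variable has to
    be confined.  The proof finds a law on the active times for which the mean
    residual of [a] vanishes almost everywhere.  As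
    [r_t(s) = K(t,s) - 1_{s <= t} a(s)], this says
    [E K(xi,s) = a(s) P(xi >= s)], which is the asserted conditional
    expectation once [P(xi >= s) > 0] (lemma [conditional_mean]).

    Existence of the law.  If [<r_t, w> > 0] held at all active times, moving
    from [a] to [a + e w] for a small [e > 0] would lower the supremum of the
    energies, by compactness of [0,1]; so every direction [w] has an active time
    with [<r_t, w> <= 0] (lemma [exists_descent]).  In place of a separation or
    minimax theorem, the law is reached by the greedy strategy of Blackwell's
    approachability theorem: choosing the [n]-th time so that
    [<r_{t_n}, S_n> <= 0], where [S_n = r_{t_0} + ... + r_{t_(n-1)}], gives
    [|S_n|^2 <= n f(a)^2], hence [S_n / n] tends to [0] (lemma
    [approachability]).  The empirical laws of the times have a weak limit
    point, realized as the law of a nondecreasing function [xi] on [0,1] with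
    Lebesgue measure, a pointwise limit of empirical quantile functions (lemma
    [weak_compactness]).  Since [t |-> <r_t, w>] is continuous, [<r_xi, w>] has
    mean [0] for all [w]; the choice [w = E r_xi] and Fubini's theorem give
    [E r_xi = 0] (lemma [mean_residual_eq0]).

    Charge near the time 1.  The kernel is self-similar,
    [K(ct,cs) = c^alpha K(t,s)], so the rescaled function
    [x(s) = c^alpha a(s/c)] satisfies [|r_{ct}(x)|^2 = c^(2H) |r_t(a)|^2].
    By convexity [|r_t(x)|^2 >= |r_t(a)|^2 - 2 <r_t(a), x - a>].  If [xi] were
    almost surely less than [c < 1], averaging over [xi] would yield
    [c^(2H) f(a)^2 >= f(a)^2], which is absurd when [f(a) > 0]
    (lemma [active_tail_gt0]).  When [f(a) = 0], [a] is [K(1,.)] and the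
    constant random variable 1 does the job.

    All the regularity comes from one estimate,
    [|K(t',s) - K(t,s)| <= B s^(-alpha) |t' - t|^alpha], in which
    [s^(-alpha)] is square integrable because [2 alpha < 1]
    (lemma [fbm_kernel_holder]). *)

Set Implicit Arguments.
Unset Strict Implicit.
Unset Printing Implicit Defensive.

Import Order.TTheory GRing.Theory Num.Theory.
Import numFieldNormedType.Exports.

Local Open Scope classical_set_scope.
Local Open Scope ring_scope.

(** * Scaling of Lebesgue integrals and a power integral *)
Section lebesgue_scaling.
Context {R : realType}.
Notation mu := (@lebesgue_measure R).

Lemma lebesgue_measure_scale (c : R) (A : set R) : 0 < c -> measurable A ->
  mu A = (c%:E * mu ( *%R c @^-1` A))%E.
Proof.
move=> c0 mA.
have mc : measurable_fun setT ( *%R c : measurableTypeR R -> measurableTypeR R).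
  exact: measurable_funM.
pose nu := (mscale (NngNum (ltW c0)) (pushforward mu ( *%R c : _ -> measurableTypeR R))
  : {measure set (measurableTypeR R) -> \bar R}).
rewrite -[RHS]/(nu mc A); apply: lebesgue_measure_unique => // _ [[a b] _ <-].
rewrite /nu/= /mscale/= /pushforward/=.
have -> : ( *%R c @^-1` `]a, b]%classic) = `]a / c, b / c]%classic.
  by apply/seteqP; split => x /=; rewrite !in_itv/= ltr_pdivrMr// ler_pdivlMr// mulrC.
rewrite !lebesgue_measure_itv/= !lte_fin ltr_pM2r ?invr_gt0//.
case: ifPn => _; last by rewrite mule0.
by rewrite -!EFinD -EFinM -mulrBl mulrC divfK// gt_eqF.
Qed.

Lemma ge0_integral_scale (c : R) (f : R -> \bar R) : 0 < c ->
  measurable_fun setT f -> (forall x, 0 <= f x)%E ->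
  (\int[mu]_x f x = c%:E * \int[mu]_x f (c * x)%R)%E.
Proof.
move=> c0 mf f0.
have mc : measurable_fun setT ( *%R c : measurableTypeR R -> measurableTypeR R).
  exact: measurable_funM.
pose nu := (mscale (NngNum (ltW c0)) (pushforward mu ( *%R c : _ -> measurableTypeR R))
  : {measure set (measurableTypeR R) -> \bar R}).
transitivity (\int[nu mc]_x f x)%E.
  apply: eq_measure_integral => A mA _; exact: lebesgue_measure_scale.
rewrite ge0_integral_mscale//= ge0_integral_pushforward//=.
Qed.

(** For [b < 1] the integrand is unbounded at [z], so the fundamental theorem
    of calculus is applied on the intervals [[z + 1/(k+1), z']], whose union is
    []z, z']]. *)
Lemma integral_powR_shift_le (b z z' : R) : 0 < b -> z <= z' ->
  (\int[mu]_(y in `[z, z']) ((y - z) `^ (b - 1))%:E <= ((z' - z) `^ b / b)%:E)%E.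
Proof.
move=> b0; rewrite le_eqVlt => /predU1P[<-|zz'].
  by rewrite set_itv1 integral_set1 lee_fin divr_ge0 ?powR_ge0 ?ltW.
have mf D : measurable_fun D (fun y : R => (y - z) `^ (b - 1)).
  apply: measurable_funTS.
  apply: (@measurableT_comp _ _ _ _ _ _ (@powR R ^~ (b - 1))).
    exact: measurable_powR.
  exact: measurable_funB.
rewrite -integral_itv_obnd_cbnd; last exact/measurable_EFinP.
pose F k : set R := `[z + k.+1%:R^-1, z']%classic.
have -> : `]z, z']%classic = \bigcup_k F k.
  apply/seteqP; split => y /=.
    rewrite in_itv/= => /andP[zy yz'].
    have y_z : 0 < y - z by rewrite subr_gt0.
    have [k _ /(_ k (leqnn k))/= hk] := near_infty_natSinv_lt (PosNum y_z).
    by exists k => //; rewrite /F/= in_itv/= yz' andbT -lerBrDl ltW.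
  move=> [k _]; rewrite /F/= !in_itv/= => /andP[zy yz]; apply/andP; split=> //.
  by apply: lt_le_trans zy; rewrite ltrDl invr_gt0.
have cv : (\int[mu]_(x in F k) ((x - z) `^ (b - 1))%:E @[k --> \oo] -->
    \int[mu]_(x in \bigcup_i F i) ((x - z) `^ (b - 1))%:E)%E.
  apply: ge0_nondecreasing_set_cvg_integral => //.
  - move=> m n mn; apply/subsetPset => y; rewrite /F/= !in_itv/= => /andP[+ ->].
    by rewrite andbT; apply: le_trans; rewrite lerD2l lef_pV2 ?posrE// ler_nat.
  - by move=> i; rewrite /F.
  - by move=> i; apply/measurable_EFinP; exact: mf.
  - by move=> i x _; rewrite lee_fin powR_ge0.
rewrite -(cvg_lim _ cv)//; apply: lime_le; first by apply/cvg_ex; eexists; exact: cv.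
apply: nearW => k; rewrite /F.
set c := z + _; have zc : z < c by rewrite /c ltrDl invr_gt0.
have [z'c|cz'] := leP z' c.
  rewrite (@integral_Sset1 _ _ _ c) ?lee_fin ?divr_ge0 ?powR_ge0 ?ltW//.
  move=> y /=; rewrite in_itv/= => /andP[cy yz'].
  by apply/eqP; rewrite eq_le cy (le_trans yz').
have d0 (y : R) : is_derive y (1:R) (fun y : R => y - z) (1:R).
  by apply: is_derive_eq; rewrite subr0.
have dP (p y : R) : z < y ->
    is_derive y 1 (fun y : R => (y - z) `^ p) (p * (y - z) `^ (p - 1)).
  rewrite -subr_gt0 => yz.
  have := @is_derive1_comp _ (@powR R ^~ p) (fun y : R => y - z) y _ _
    (is_derive1_powR p yz) (d0 y).
  by rewrite mulr1.
have dF y : z < y ->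
    is_derive y 1 (fun y : R => b^-1 * (y - z) `^ b) ((y - z) `^ (b - 1)).
  move=> zy; have := @is_deriveZ _ _ _ _ b^-1 y 1 _ (dP b y zy).
  by rewrite /GRing.scale/= mulKf// gt_eqF.
have cF y : z < y -> {for y, continuous (fun y : R => b^-1 * (y - z) `^ b)}.
  move=> zy; apply/differentiable_continuous/derivable1_diffP.
  by have [] := dF y zy.
rewrite (@continuous_FTC2 _ _ (fun y => b^-1 * (y - z) `^ b))//.
- rewrite -EFinB lee_fin mulrC lerBlDr lerDl mulr_ge0 ?invr_ge0 ?powR_ge0 ?ltW//.
- apply: derivable_within_continuous => y; rewrite in_itv/= => /andP[cy _].
  by have [] := dP (b - 1) y (lt_le_trans zc cy).
- split.
  + move=> y; rewrite in_itv/= => /andP[cy _].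
    by have [] := dF y (lt_trans zc cy).
  + exact/cvg_at_right_filter/cF.
  + by apply/cvg_at_left_filter/cF.
- move=> y; rewrite in_itv/= => /andP[cy _].
  by rewrite derive1E; have [_ ->] := dF y (lt_trans zc cy).
Qed.

End lebesgue_scaling.

(** * Estimates on the fractional Brownian kernel *)

Lemma measurable_powR_comp (R : realType) d (T : measurableType d) (D : set T)
    (f : T -> R) (p : R) :
  measurable_fun D f -> measurable_fun D (fun x => f x `^ p).
Proof.
move=> mf; apply: (@measurable_comp _ _ _ _ _ _ setT (@powR R ^~ p)) => //.
Qed.

Section kernel.
Context {R : realType} (H : R).
Hypothesis H_gt : 2^-1 < H.
Hypothesis H_lt : H < 1.
Notation mu := (@lebesgue_measure R).
Let alpha := fbm_alpha H.

Lemma fbm_alpha_gt0 : 0 < alpha.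
Proof. by rewrite /alpha /fbm_alpha subr_gt0. Qed.

Lemma fbm_alpha2_lt1 : 2 * alpha < 1.
Proof. by move: H_lt; rewrite /alpha /fbm_alpha; lra. Qed.

Let phi (s u : R) := u `^ alpha * (u - s) `^ (alpha - 1).

Let measurable_phi s D : measurable_fun D (phi s).
Proof.
apply: measurable_funM; first by apply: measurable_powR_comp; exact: measurable_id.
apply: measurable_powR_comp; apply: measurable_funB => //.
Qed.

Let phi_ge0 s u : 0 <= phi s u.
Proof. by rewrite mulr_ge0 ?powR_ge0. Qed.

Let phi_int_le (s x y : R) : 0 < s -> s <= x -> x <= y ->
  (\int[mu]_(u in `[x, y]) (phi s u)%:E <=
   (y `^ alpha * ((y - x) `^ alpha / alpha))%:E)%E.
Proof.
move=> s0 sx xy; have a0 := fbm_alpha_gt0; have a1 := fbm_alpha2_lt1.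
apply: (@le_trans _ _ (\int[mu]_(u in `[x, y])
    ((y `^ alpha)%:E * ((u - x) `^ (alpha - 1))%:E)))%E; last first.
  rewrite ge0_integralZl//.
  - by rewrite EFinM lee_wpmul2l ?lee_fin ?powR_ge0// integral_powR_shift_le.
  - apply/measurable_EFinP; apply: measurable_powR_comp; apply: measurable_funB => //.
  - by move=> *; rewrite lee_fin powR_ge0.
  - by rewrite lee_fin powR_ge0.
rewrite -[leLHS]integral_itv_obnd_cbnd; last first.
  by apply/measurable_EFinP; exact: measurable_phi.
rewrite -[leRHS]integral_itv_obnd_cbnd; last first.
  apply/measurable_EFinP; apply: measurable_funM => //.
  by apply: measurable_powR_comp; apply: measurable_funB.
apply: ge0_le_integral => //.
- by move=> u _; rewrite lee_fin.
- by apply/measurable_EFinP; exact: measurable_phi.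
- apply/measurable_EFinP; apply: measurable_funM => //.
  by apply: measurable_powR_comp; apply: measurable_funB.
move=> u; rewrite /= in_itv/= => /andP[xu uy]; rewrite lee_fin /phi.
have u0 : 0 < u by lra.
rewrite ler_pM ?powR_ge0//.
  by apply: ge0_ler_powR; rewrite ?nnegrE; lra.
have -> : alpha - 1 = - (1 - alpha) by ring.
rewrite !powRN lef_pV2 ?posrE ?powR_gt0 ?subr_gt0//; last lra.
by apply: ge0_ler_powR; rewrite ?nnegrE; lra.
Qed.

Let phi_integrable (s x y : R) : 0 < s -> s <= x ->
  mu.-integrable `[x, y] (EFin \o phi s).
Proof.
move=> s0 sx; have [xy|yx] := leP x y; last first.
  by rewrite set_itv_ge ?integrable_set0// -leNgt bnd_simp.
apply/integrableP; split; first by apply/measurable_EFinP; exact: measurable_phi.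
under eq_integral do rewrite /= ger0_norm//.
by apply: le_lt_trans (phi_int_le _ _ _) _; rewrite ?ltry.
Qed.

Let I (s t : R) := Rintegral mu `[s, t] (phi s).

Let fbm_kernelE t s : fbm_kernel H t s =
  if [&& 0 < s, s < t & t <= 1] then fbm_C H * s `^ (- alpha) * I s t else 0.
Proof. by []. Qed.

Lemma fbm_kernel_out t s : ~~ (0 < s < t) -> fbm_kernel H t s = 0.
Proof. by rewrite fbm_kernelE andbA => /negbTE ->. Qed.

Let RI_le (s x y : R) : 0 < s -> s <= x -> x <= y -> y <= 1 ->
  Rintegral mu `[x, y] (phi s) <= (y - x) `^ alpha / alpha.
Proof.
move=> s0 sx xy y1; have a0 := fbm_alpha_gt0; rewrite -lee_fin fineK; last first.
  by apply: integrable_fin_num => //; exact: phi_integrable.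
apply: le_trans (phi_int_le s0 sx xy) _; rewrite lee_fin ler_piMl//.
  by rewrite divr_ge0 ?powR_ge0 ?ltW.
have -> : 1 = 1 `^ alpha :> R by rewrite powR1.
by apply: ge0_ler_powR; rewrite ?nnegrE; lra.
Qed.

(** Bounding [u^alpha] by 1 and [(u - s)^(alpha - 1)] by [(u - t)^(alpha - 1)]
    leaves a power integral over [[t, t']].  When [t <= s < t'] the kernel
    vanishes at [t] and [s] takes the place of [t]. *)
Lemma fbm_kernel_holder (t t' s : R) : 0 <= t -> t <= t' -> t' <= 1 ->
  `|fbm_kernel H t' s - fbm_kernel H t s| <=
  `|fbm_C H| / alpha * s `^ (- alpha) * (t' - t) `^ alpha.
Proof.
move=> t0 tt' t'1; have a0 := fbm_alpha_gt0.
have [s0|s0] := leP s 0.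
  rewrite !fbm_kernel_out ?subrr ?normr0; try lra.
  by rewrite !mulr_ge0 ?powR_ge0// invr_ge0 ltW.
have key : forall D, 0 <= D <= (t' - t) `^ alpha / alpha ->
    `|fbm_C H * s `^ (- alpha) * D| <=
    `|fbm_C H| / alpha * s `^ (- alpha) * (t' - t) `^ alpha.
  move=> D /andP[D0 D1]; rewrite normrM (ger0_norm D0) normrM (ger0_norm (powR_ge0 _ _)).
  have -> : `|fbm_C H| / alpha * s `^ (- alpha) * (t' - t) `^ alpha =
     `|fbm_C H| * s `^ (- alpha) * ((t' - t) `^ alpha / alpha) by ring.
  by rewrite ler_wpM2l// mulr_ge0 ?powR_ge0.
rewrite !fbm_kernelE s0 t'1 (le_trans tt' t'1) !andbT/=.
have [st|ts] := ltP s t.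
  rewrite (lt_le_trans st tt') -mulrBr; apply: key.
  have -> : I s t' - I s t = Rintegral mu `]t, t'] (phi s).
    apply: Rintegral_itvB; rewrite ?bnd_simp//; last exact: ltW.
    exact: phi_integrable.
  rewrite Rintegral_itv_obnd_cbnd; last first.
    have := @integrableS _ _ _ mu `[t, t']%classic `]t, t']%classic.
    apply => //.
    - by apply: subset_itvr; rewrite bnd_simp.
    - by apply: phi_integrable => //; exact: ltW.
  apply/andP; split; first by apply: Rintegral_ge0 => ? _; exact: phi_ge0.
  by apply: RI_le => //; exact: ltW.
have [st'|t's] := ltP s t'; last first.
  by rewrite subrr normr0 !mulr_ge0 ?powR_ge0// invr_ge0 ltW.
rewrite subr0; apply: key; apply/andP; split.
  by apply: Rintegral_ge0 => ? _; exact: phi_ge0.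
apply: le_trans (RI_le _ _ _ _) _ => //; first exact: ltW.
rewrite ler_pM2r ?invr_gt0//.
by apply: ge0_ler_powR; rewrite ?nnegrE; lra.
Qed.

(* By the substitution [u = s y] the kernel is [C s^alpha Psi(t / s)], which
   shows its self-similarity; joint measurability follows because [Psi] is
   nondecreasing. *)
Let Psi (z : R) := Rintegral mu `[1, z] (phi 1).

Let I_scale (s t : R) : 0 < s -> I s t = s `^ (2 * alpha) * Psi (t / s).
Proof.
move=> s0; rewrite /I /Psi /Rintegral.
rewrite integral_mkcond (ge0_integral_scale s0); last 2 first.
- apply/(measurable_restrictT _ _).1 => //.
  by apply/measurable_EFinP; exact: measurable_phi.
- by move=> u; apply: erestrict_ge0 => v _; rewrite lee_fin.
rewrite [in RHS]integral_mkcond.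
transitivity (fine (s%:E * \int[mu]_x ((s `^ alpha * s `^ (alpha - 1))%:E *
    ((fun u => (phi 1 u)%:E) \_ `[1%R, (t / s)%R]) x)))%E.
  congr (fine (_ * _)); apply: eq_integral => u _; rewrite !patchE.
  have -> : (s * u \in `[s, t]%classic) = (u \in `[1, t / s]%classic).
    by rewrite !mem_setE !in_itv/= ler_pdivlMr// [u * s]mulrC -{1}[s]mulr1 ler_pM2l.
  case: ifPn; last by rewrite mule0.
  rewrite inE/= in_itv/= => /andP[u1 _]; rewrite -EFinM /phi; congr EFin.
  have -> : s * u - s = s * (u - 1) by ring.
  rewrite !powRM; [ring|exact: ltW|lra|exact: ltW|lra].
rewrite ge0_integralZl//; last 3 first.
- apply/(measurable_restrictT _ _).1 => //.
  by apply/measurable_EFinP; exact: measurable_phi.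
- by move=> u _; apply: erestrict_ge0 => v _; rewrite lee_fin.
- by rewrite lee_fin mulr_ge0 ?powR_ge0.
rewrite muleA fineM//; last first.
  rewrite -integral_mkcond; apply: integrable_fin_num => //.
  exact: phi_integrable.
congr (_ * _); rewrite /= mulrCA mulr_powRB1 ?fbm_alpha_gt0 ?ltW//.
by rewrite mulr2n mulrDl mul1r (@powRD _ s alpha alpha)// (gt_eqF s0) implybT.
Qed.

Lemma fbm_kernel_homogeneous (t s : R) : fbm_kernel H t s =
  if [&& 0 < s, s < t & t <= 1] then fbm_C H * s `^ alpha * Psi (t / s) else 0.
Proof.
rewrite fbm_kernelE; case: ifPn => [/and3P[s0 _ _]|//].
have {2}-> : alpha = - alpha + 2 * alpha by ring.
rewrite I_scale// (@powRD _ s (- alpha) (2 * alpha)); last by rewrite (gt_eqF s0) implybT.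
ring.
Qed.

Lemma fbm_kernel_scale (c t s : R) : 0 < c -> c <= 1 -> t <= 1 ->
  fbm_kernel H (c * t) (c * s) = c `^ alpha * fbm_kernel H t s.
Proof.
move=> c0 c1 t1; rewrite !fbm_kernel_homogeneous pmulr_rgt0// ltr_pM2l//.
case: ifPn => [/and3P[s0 st _]|].
  rewrite s0 st t1/= powRM; [|exact: ltW..].
  have -> : c * t / (c * s) = t / s by field; rewrite !gt_eqF.
  ring.
case: ifPn; last by rewrite mulr0.
move=> /and3P[s0 st _]; rewrite s0 st/= => /negP[].
by rewrite (le_trans (ler_pM (ltW c0) (ltW (lt_trans s0 st)) c1 t1))// mulr1.
Qed.

Let Psi_nd : {homo Psi : x y / x <= y}.
Proof.
move=> x y xy; rewrite /Psi /Rintegral; apply: fine_le.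
- by apply: integrable_fin_num => //; exact: phi_integrable.
- by apply: integrable_fin_num => //; exact: phi_integrable.
apply: ge0_subset_integral => //.
- by apply/measurable_EFinP; exact: measurable_phi.
- by move=> u _; rewrite lee_fin.
- by apply: subset_itvl; rewrite bnd_simp.
Qed.

Lemma measurable_fbm_kernel :
  measurable_fun [set: R * R] (fun z : R * R => fbm_kernel H z.1 z.2).
Proof.
rewrite (_ : (fun _ => _) = (fun z : R * R =>
   if [&& 0 < z.2, z.2 < z.1 & z.1 <= 1] then
   fbm_C H * z.2 `^ alpha * Psi (z.1 * z.2 `^ (-1)) else 0)); last first.
  apply/funext => z; rewrite fbm_kernel_homogeneous.
  by case: ifPn => // /andP[z0 _]; rewrite powR_inv1// ltW.
apply: measurable_fun_ifT => //.
- apply: measurable_and; first exact: measurable_fun_ltr.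
  apply: measurable_and; first exact: measurable_fun_ltr.
  exact: measurable_fun_ler.
- apply: measurable_funM.
    by apply: measurable_funM => //; exact: measurable_powR_comp.
  apply: (@measurableT_comp _ _ _ _ _ _ Psi).
    exact: nondecreasing_measurable.
  apply: measurable_funM => //.
  exact: measurable_powR_comp.
Qed.

End kernel.

(** * The uniform probability on the unit interval *)
Section uniform.
Context {R : realType}.
Notation mu := (@lebesgue_measure R).
Notation P := (uniform_prob (@ltr01 R)).

Lemma integral_uniform01 (f : R -> \bar R) :
  measurable_fun setT f -> (forall x, 0 <= f x)%E ->
  (\int[P]_x f x = \int[mu]_(x in `[0%R, 1%R]) f x)%E.
Proof. by move=> mf f0; rewrite integral_uniform// subr0 invr1 mul1e. Qed.

Lemma uniform_prob01E (A : set R) : measurable A ->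
  P A = mu (A `&` `[0, 1[).
Proof.
move=> mA; rewrite -[A in LHS]setIT -integral_indic// integral_uniform01//.
- rewrite -integral_itv_bndo_bndc; last by apply/measurable_EFinP.
  by rewrite integral_indic.
- by apply/measurable_EFinP.
Qed.

Lemma integral_uniform_step (n : nat) (psi : nat -> R) :
  \int[P]_w psi (minn (Num.truncn (n.+1%:R * w)) n) =
  n.+1%:R^-1 * \sum_(i < n.+1) psi i.
Proof.
pose idx (w : R) := minn (Num.truncn (n.+1%:R * w)) n.
pose L j : set R := [set w | idx w = j].
have idx_nd : {homo idx : x y / (x <= y)%R >-> (x <= y)%N}.
  move=> x y xy; rewrite leq_min geq_minr andbT geq_min le_truncn//.
  by rewrite ler_wpM2l.
have mL j : measurable (L j).
  apply: is_interval_measurable => x y /= xj yj z /andP[xz zy].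
  by apply/eqP; rewrite eqn_leq -[X in (_ <= X)%N]yj -[X in (X <= idx z)%N]xj !idx_nd.
have PL j : (j < n.+1)%N -> P (L j) = (n.+1%:R^-1)%:E.
  move=> jn; rewrite uniform_prob01E//.
  have -> : L j `&` `[0, 1[ = `[j%:R / n.+1%:R, j.+1%:R / n.+1%:R[%classic.
    apply/seteqP; split => w; rewrite /L/= !in_itv/= /idx.
      move=> [wj /andP[w0 w1]].
      have nw : n.+1%:R * w < n.+1%:R by rewrite -[ltRHS]mulr1 ltr_pM2l.
      have nw0 : 0 <= n.+1%:R * w by rewrite mulr_ge0.
      move: wj; rewrite (minn_idPl _); last by rewrite truncn_le_nat.
      move=> wj; have := truncn_itv nw0.
      by rewrite wj ler_pdivrMr// ltr_pdivlMr// mulrC.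
    rewrite ler_pdivrMr// ltr_pdivlMr// => /andP[jw wj].
    have w0 : 0 <= w by rewrite -(@pmulr_lge0 _ n.+1%:R)// (le_trans _ jw).
    have w1 : w < 1.
      by rewrite -(@ltr_pM2r _ n.+1%:R)// mul1r (lt_le_trans wj)// ler_nat.
    split; last by rewrite w0.
    have -> : Num.truncn (n.+1%:R * w) = j.
      by apply: truncn_def; rewrite mulrC jw.
    by apply/minn_idPl; rewrite -ltnS.
  rewrite lebesgue_measure_itv/= lte_fin ltr_pM2r ?invr_gt0// ltr_nat ltnSn.
  by rewrite -EFinD -mulrBl -natrB// subSnn mul1r.
rewrite /Rintegral (_ : (fun _ => _) =
    fun w => (\sum_(j < n.+1) (psi j * \1_(L j) w)%:E)%E); last first.
  apply/funext => w; rewrite sumEFin; congr EFin.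
  have wn : (idx w < n.+1)%N by rewrite ltnS geq_minr.
  rewrite (bigD1 (Ordinal wn))//= indicE mem_set// mulr1 big1 ?addr0// => j jw.
  rewrite indicE memNset ?mulr0// /L/= => wj.
  by move/negP: jw; apply; apply/eqP/val_inj.
have iL j : P.-integrable setT (fun w => (psi j * \1_(L j) w)%:E).
  under eq_fun do rewrite EFinM; apply: integrableZl => //.
  exact: (@integrable_indic _ _ _ P (L j) (mL j)).
rewrite integral_sum//.
rewrite (eq_bigr (fun j : 'I_n.+1 => (psi j * n.+1%:R^-1)%:E)); last first.
  move=> j _; under eq_integral do rewrite EFinM.
  rewrite integralZl//; last first.
    exact: (@integrable_indic _ _ _ P (L j) (mL j)).
  rewrite EFinM; congr (_ * _)%E.
  by rewrite (@integral_indic _ _ _ P _ measurableT _ (mL j)) setIT; exact: PL.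
by rewrite sumEFin/= mulrC mulr_suml.
Qed.

End uniform.

(** * Weak limits of empirical laws *)
Section quantile.
Context {R : realType}.
Notation P := (uniform_prob (@ltr01 R)).
Implicit Types (t : nat -> R) (w : R).

(** The quantile function of the empirical law of [t 0, ..., t n]: the sorted
    sample is traversed at constant speed on [[0, 1]], and extended by constants
    to a nondecreasing function on the whole line. *)
Definition quantile t (n : nat) (w : R) : R :=
  nth 0 (sort <=%R (mkseq t n.+1)) (minn (Num.truncn (n.+1%:R * w)) n).

Lemma quantile_in t n w : exists i, quantile t n w = t i.
Proof.
have : quantile t n w \in mkseq t n.+1.
  by rewrite -(mem_sort <=%R) mem_nth// size_sort size_mkseq ltnS geq_minr.
by move=> /mapP[i _ ->]; exists i.
Qed.

Lemma quantile_nd t n : {homo quantile t n : x y / x <= y}.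
Proof.
move=> x y xy; apply: (@sorted_leq_nth _ <=%R le_trans lexx).
- exact: sort_le_sorted.
- by rewrite inE size_sort size_mkseq ltnS geq_minr.
- by rewrite inE size_sort size_mkseq ltnS geq_minr.
- by rewrite leq_min geq_minr andbT geq_min le_truncn// ler_wpM2l.
Qed.

Lemma integral_quantile (phi : R -> R) t n :
  \int[P]_w phi (quantile t n w) = n.+1%:R^-1 * \sum_(i < n.+1) phi (t i).
Proof.
rewrite /quantile.
rewrite (@integral_uniform_step _ _ (fun i => phi (nth 0 (sort <=%R (mkseq t n.+1)) i))).
congr (_ * _).
transitivity (\sum_(x <- sort <=%R (mkseq t n.+1)) phi x).
  by rewrite [RHS](big_nth 0) size_sort size_mkseq big_mkord.
rewrite (perm_big (mkseq t n.+1)) ?perm_sort//.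
by rewrite /mkseq big_map -(big_mkord xpredT (phi \o t)) /index_iota subn0.
Qed.

Lemma ultra_cvg_compact (U : set_system nat) (x : nat -> R) (A : set R) :
  UltraFilter U -> compact A -> (forall n, A (x n)) ->
  exists p, A p /\ x n @[n --> U] --> p.
Proof.
move=> UU cA xA.
have [p [Ap clp]] := cA (x n @[n --> U]) _ (@filterE _ U _ _ xA).
exists p; split => // V Vp.
have [//|UnV] := in_ultra_setVsetC (x @^-1` V) UU.
have [y [nVy Vy]] := clp (~` V) V UnV Vp.
by exfalso; exact: nVy Vy.
Qed.

(** A monotone function has countably many discontinuities. *)
Lemma nondecreasing_ae_continuous (xi : R -> R) : {homo xi : x y / x <= y} ->
  {ae P, forall w, 0 < w < 1 /\ {for w, continuous xi}}.
Proof.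
move=> ndxi.
pose D := [set x : R | x \in (`]0, 1[) /\ discontinuity xi x].
have cD : countable D by apply: discontinuity_countable => x y _ _; exact: ndxi.
have mD : measurable (D : set R).
  exact: countable_measurable.
exists (D `|` ~` `]0, 1[); split => //.
- by apply: measurableU => //; exact: measurableC.
- rewrite uniform_prob01E; last first.
    by apply: measurableU => //; exact: measurableC.
  apply: (@subset_measure0 _ _ _ (@lebesgue_measure R) _ (D `|` [set 0])).
  - by apply: measurableI => //; apply: measurableU => //; exact: measurableC.
  - exact: measurableU.
  - move=> w [[Dw|] + ]; first by left.
    rewrite /= !in_itv/= => /negP; rewrite negb_and -!leNgt => /orP[w0|w1] /andP[w0' w1'].
      by right; apply/eqP; rewrite eq_le w0 w0'.
    by exfalso; lra.
  - apply: null_set_setU => //; first exact: countable_lebesgue_measure0.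
    exact: lebesgue_measure_set1.
move=> w /= nw; apply: contrapT => nD; apply: nw.
have [|w01] := pselect (~ (w \in `]0, 1[)); first by move=> h; exfalso; apply: nD; right.
move/contrapT : w01 => w01; move: (w01); rewrite in_itv/= => /andP[w0 w1].
split; first by rewrite w0 w1.
have ndisc : ~ discontinuity xi w by move=> dw; apply: nD; left; split.
have cl : cvg (xi x @[x --> w^'-]).
  apply: nondecreasing_at_left_is_cvgr.
    by apply: nearW => x y z _ _; exact: ndxi.
  apply: nearW => x; exists (xi w) => _ /= [y /= + <-].
  by rewrite in_itv/= => /andP[_ /ltW]; exact: ndxi.
have cr : cvg (xi x @[x --> w^'+]).
  apply: nondecreasing_at_right_is_cvgr.
    by apply: nearW => x y z _ _; exact: ndxi.
  apply: nearW => x; exists (xi w) => _ /= [y /= + <-].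
  by rewrite in_itv/= => /andP[/ltW + _]; exact: ndxi.
have elr : lim (xi x @[x --> w^'-]) = lim (xi x @[x --> w^'+]).
  by apply/eqP/negPn/negP => h; apply: ndisc.
have le1 : lim (xi x @[x --> w^'-]) <= xi w.
  by apply: limr_le => //; near=> x; apply: ndxi; near: x; exact: nbhs_left_le.
have le2 : xi w <= lim (xi x @[x --> w^'+]).
  by apply: limr_ge => //; near=> x; apply: ndxi; near: x; exact: nbhs_right_ge.
have e1 : lim (xi x @[x --> w^'-]) = xi w.
  by apply/eqP; rewrite eq_le le1 elr.
have cvl : xi x @[x --> w^'-] --> lim (xi x @[x --> w^'-]) := cl.
have cvr : xi x @[x --> w^'+] --> lim (xi x @[x --> w^'+]) := cr.
by rewrite -elr e1 in cvr; rewrite e1 in cvl; apply/left_right_continuousP.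
Unshelve. all: by end_near.
Qed.

(** Prokhorov's theorem on [[0, 1]], in the form of Helly's selection theorem for
    the quantile functions.  Their limit along an ultrafilter exists at every
    point; a subsequence which is close to the limit on finer and finer grids
    converges at each point of continuity of the limit, by monotonicity, and
    dominated convergence applies. *)
Lemma weak_compactness (t : nat -> R) (G : set R) :
  closed G -> G `<=` `[0, 1] -> (forall i, G (t i)) ->
  exists2 xi : R -> R, {homo xi : x y / x <= y} /\ (forall w, G (xi w)) &
  exists2 k : nat -> nat, (forall m, (m <= k m)%N) &
    forall phi : R -> R, {within `[0, 1], continuous phi} ->
      (k m).+1%:R^-1 * \sum_(i < (k m).+1) phi (t i) @[m --> \oo] -->
      \int[P]_w phi (xi w).
Proof.
move=> clG G01 Gt.
have cG : compact G.
  exact: (subclosed_compact clG (@segment_compact _ 0 1) G01).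
have Gq n w : G (quantile t n w) by have [i ->] := quantile_in t n w.
have [U [UU ooU]] := ultraFilterLemma eventually_filter.
have PU : ProperFilter U := ultra_proper.
have /choice[xi xiP] : forall w, exists p,
    G p /\ quantile t n w @[n --> U] --> p.
  by move=> w; apply: ultra_cvg_compact cG _.
have xi_nd : {homo xi : x y / x <= y}.
  move=> x y xy; apply: (ler_cvg_to (xiP x).2 (xiP y).2).
  by apply: filterE => n; exact: quantile_nd.
exists xi; first by split => // w; exact: (xiP w).1.
have /choice[k kP] : forall m, exists n, (m <= n)%N /\
    forall i : 'I_m.+2,
    `|xi (i%:R / m.+1%:R) - quantile t n (i%:R / m.+1%:R)| < m.+1%:R^-1.
  move=> m; apply: (@filter_ex _ U); apply: filterI.
    by apply: ooU; exists m.
  apply: filter_forall => i.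
  have /cvgrPdist_lt := (xiP (i%:R / m.+1%:R)).2; apply.
  by rewrite invr_gt0.
exists k; first by move=> m; have [] := kP m.
have q_cvg w : 0 < w < 1 -> {for w, continuous xi} ->
    quantile t (k m) w @[m --> \oo] --> xi w.
  move=> /andP[w0 w1] cw; apply/cvgrPdist_lt => e e0.
  have e20 : 0 < e / 2 by rewrite divr_gt0.
  have /cvgrPdist_lt/(_ _ e20)/nbhs_ballP[d /= d0 dP] := cw.
  near=> m.
  pose N : R := m.+1%:R.
  have N0 : 0 < N by rewrite ltr0n.
  have Nd : N^-1 < d.
    by rewrite /N; near: m; exact: (near_infty_natSinv_lt (PosNum d0)).
  have Ne : N^-1 < e / 2.
    by rewrite /N; near: m; exact: (near_infty_natSinv_lt (PosNum e20)).
  (* [w] lies between the grid points [i / N] and [(i + 1) / N] *)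
  pose i := Num.truncn (N * w).
  have /andP[iw wi] : i%:R <= N * w < i.+1%:R.
    by apply: truncn_itv; rewrite mulr_ge0// ltW.
  have im : (i < m.+1)%N.
    by rewrite /i truncn_lt_nat ?mulr_ge0 ?ltW// -[ltRHS]mulr1 ltr_pM2l.
  have iw' : i%:R / N <= w by rewrite ler_pdivrMr// mulrC.
  have wi' : w <= i.+1%:R / N by rewrite ler_pdivlMr// mulrC ltW.
  have diff : i.+1%:R / N = i%:R / N + N^-1 by rewrite -natr1 mulrDl mul1r.
  have [_ kmP] := kP m.
  have := kmP (Ordinal (leqW im)); have := kmP (Ordinal (im : i.+1 < m.+2)%N).
  rewrite /= -/N => h1 h2.
  have b1 : `|xi w - xi (i%:R / N)| < e / 2.
    apply: dP; rewrite /ball/= ger0_norm ?subr_ge0//.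
    by apply: le_lt_trans Nd; rewrite lerBlDl -diff.
  have b2 : `|xi w - xi (i.+1%:R / N)| < e / 2.
    apply: dP; rewrite /ball/= distrC ger0_norm ?subr_ge0//.
    by apply: le_lt_trans Nd; rewrite diff lerBlDl lerD2r.
  have m1 := quantile_nd t (k m) iw'; have m2 := quantile_nd t (k m) wi'.
  move: h1 h2 b1 b2 m1 m2 Ne; rewrite !ltr_norml.
  set q1 := quantile t (k m) (i%:R / N); set q2 := quantile t (k m) (i.+1%:R / N).
  set x1 := xi (i%:R / N); set x2 := xi (i.+1%:R / N); set v := N^-1.
  clearbody q1 q2 x1 x2 v.
  move=> /andP[h1 h1'] /andP[h2 h2'] /andP[b1 b1'] /andP[b2 b2'] m1 m2 Ne.
  by apply/andP; split; lra.
move=> phi cphi.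
rewrite (_ : (fun m => _) = fun m => \int[P]_w phi (quantile t (k m) w)); last first.
  by apply/funext => m; rewrite integral_quantile.
have mphi : measurable_fun (`[0, 1] : set R) phi.
  exact: subspace_continuous_measurable_fun.
have mcomp (f : R -> R) : {homo f : x y / x <= y} -> (forall w, G (f w)) ->
    measurable_fun setT (fun w => (phi (f w))%:E).
  move=> fnd Gf; apply/measurable_EFinP.
  apply: (measurable_comp _ _ mphi) => //.
    by move=> _ [w _ <-]; exact: G01.
  exact: nondecreasing_measurable.
have [M M0 phiM] : exists2 M, 0 <= M & forall x, G x -> `|phi x| <= M.
  have /compact_bounded[M [_ MP]] :=
    continuous_compact cphi (@segment_compact _ 0 1).
  exists (Num.max 0 (M + 1)); first by rewrite le_max lexx.
  move=> x Gx; rewrite le_max; apply/orP; right.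
  by apply: (MP (M + 1)); [rewrite ltrDl|exists x => //; exact: G01].
have [||||| ixi _ cv] := @dominated_convergence _ _ _ P setT measurableT
  (fun m w => (phi (quantile t (k m) w))%:E) (fun w => (phi (xi w))%:E) (cst M%:E).
- by move=> m; apply: mcomp => // ; exact: quantile_nd.
- by apply: mcomp => // w; exact: (xiP w).1.
- have := nondecreasing_ae_continuous xi_nd.
  apply: (@filterS _ _ (@ae_filter_ringOfSetsType _ _ _ P)) => w [w01 cw] _.
  apply/fine_cvgP; split; first exact: nearW.
  have qw : quantile t (k m) w @[m --> \oo] --> within `[0, 1] (nbhs (xi w)).
    move=> V wV; have qV : \forall m \near \oo,
        `[0, 1]%classic (quantile t (k m) w) -> V (quantile t (k m) w).
      exact: (q_cvg _ w01 cw _ wV).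
    apply: (@filterS _ \oo _ _ _ _ qV) => m; apply; exact: G01.
  have cphiw : phi y @[y --> within `[0, 1] (nbhs (xi w))] --> phi (xi w).
    have /subspace_continuousP := cphi; apply.
    by apply: G01; exact: (xiP w).1.
  exact: (cvg_comp _ _ qw cphiw).
- exact: finite_measure_integrable_cst.
- by apply: aeW => w m _; rewrite lee_fin phiM.
apply: fine_cvg; rewrite fineK //; exact: integrable_fin_num.
Unshelve. all: by end_near.
Qed.

End quantile.

(** * Inner products of square integrable functions *)
Section L2_inner_product.
Context d (T : measurableType d) (R : realType).
Variable mu : {measure set T -> \bar R}.
Implicit Types u v w f g : T -> R.

Definition dot u w : R := \int[mu]_x (u x * w x).

Local Notation L2 := (Lfun mu 2%:E).

Lemma L2_measurable f : f \in L2 -> measurable_fun setT f.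
Proof. by move=> /sub_Lfun_mfun; rewrite inE. Qed.

Lemma L2P f : measurable_fun setT f ->
  (\int[mu]_x ((f x) ^+ 2)%:E < +oo)%E -> f \in L2.
Proof.
move=> mf fi; rewrite inE; apply/andP; split; rewrite inE//=.
rewrite /finite_norm unlock /Lnorm poweR_lty//.
rewrite (eq_integral (fun x => ((f x) ^+ 2)%:E))// => x _.
by rewrite /= powR_mulrn// real_normK// num_real.
Qed.

Lemma L2_dominated f g : g \in L2 -> measurable_fun setT f ->
  (forall x, `|f x| <= `|g x|) -> f \in L2.
Proof.
move=> g2 mf fg; apply: L2P => //.
have /integrableP[_ +] := Lfun2_integrable_sqr g2; apply: le_lt_trans.
apply: ge0_le_integral => //.
- by move=> x _; rewrite lee_fin sqr_ge0.
- by apply/measurable_EFinP; exact: measurable_funX.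
- apply: measurableT_comp => //; apply/measurable_EFinP.
  by apply: measurable_funX; exact: L2_measurable.
- move=> x _ /=; rewrite lee_fin normrX -real_normK ?num_real//.
  by rewrite lerXn2r ?nnegrE.
Qed.

Let L2_submod : submod_closed L2.
Proof. exact: Lfun_submod_closed (lee1n 2). Qed.

Lemma L2D u w : u \in L2 -> w \in L2 -> (fun x => u x + w x) \in L2.
Proof.
move=> u2 w2; have := L2_submod.2 1 u w u2 w2; rewrite scale1r; exact.
Qed.

Lemma L2Z (c : R) u : u \in L2 -> (fun x => c * u x) \in L2.
Proof.
move=> u2; have := L2_submod.2 c u 0 u2 L2_submod.1; rewrite addr0; exact.
Qed.

Lemma L2B u w : u \in L2 -> w \in L2 -> (fun x => u x - w x) \in L2.
Proof.
move=> u2 w2; have := L2_submod.2 (-1) w u w2 u2.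
by rewrite scaleN1r addrC; exact.
Qed.

Lemma integrable_L2M u w : u \in L2 -> w \in L2 ->
  mu.-integrable setT (fun x => (u x * w x)%:E).
Proof. by move=> u2 w2; apply/(Lfun1_integrable mu (u \* w)); exact: Lfun2_mul_Lfun1. Qed.

Lemma dotC u w : dot u w = dot w u.
Proof. by apply: eq_Rintegral => x _; rewrite mulrC. Qed.

Lemma dotDl u v w : u \in L2 -> v \in L2 -> w \in L2 ->
  dot (fun x => u x + v x) w = dot u w + dot v w.
Proof.
move=> u2 v2 w2; rewrite -RintegralD//; [|exact: integrable_L2M..].
by apply: eq_Rintegral => x _; rewrite mulrDl.
Qed.

Lemma dotBl u v w : u \in L2 -> v \in L2 -> w \in L2 ->
  dot (fun x => u x - v x) w = dot u w - dot v w.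
Proof.
move=> u2 v2 w2; rewrite -RintegralB//; [|exact: integrable_L2M..].
by apply: eq_Rintegral => x _; rewrite mulrBl.
Qed.

Lemma dotZl (c : R) u w : u \in L2 -> w \in L2 ->
  dot (fun x => c * u x) w = c * dot u w.
Proof.
move=> u2 w2; rewrite -RintegralZl//; last exact: integrable_L2M.
by apply: eq_Rintegral => x _; rewrite mulrA.
Qed.

Lemma dot_ge0 u : 0 <= dot u u.
Proof. by apply: Rintegral_ge0 => x _; rewrite -expr2 sqr_ge0. Qed.

Lemma dot_sqrD u w : u \in L2 -> w \in L2 ->
  dot (fun x => u x + w x) (fun x => u x + w x) = dot u u + 2 * dot u w + dot w w.
Proof.
move=> u2 w2; rewrite dotDl//; last exact: L2D.
rewrite (dotC u (fun=> _)) (dotC w (fun=> _)) !dotDl// (dotC w u); ring.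
Qed.

Lemma dot_sqrD_le u w : u \in L2 -> w \in L2 ->
  dot (fun x => u x + w x) (fun x => u x + w x) <= 2 * (dot u u + dot w w).
Proof.
move=> u2 w2; have := dot_ge0 (fun x => u x + (-1) * w x).
have e v : v \in L2 -> dot v (fun x => -1 * w x) = - 1 * dot v w.
  by move=> v2; rewrite dotC dotZl// dotC.
rewrite !dot_sqrD ?L2Z// !e ?L2Z// dotZl//; lra.
Qed.

(** The squared norm of [u + c w] is nonnegative at the [c] which minimizes it;
    when [w] has norm 0 it is affine in [c], so its slope is 0. *)
Lemma dot_Cauchy_Schwarz u w : u \in L2 -> w \in L2 ->
  (dot u w) ^+ 2 <= dot u u * dot w w.
Proof.
move=> u2 w2.
have h (c : R) : 0 <= dot u u + 2 * c * dot u w + c ^+ 2 * dot w w.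
  have := dot_ge0 (fun x => u x + c * w x).
  have e1 v : v \in L2 -> dot v (fun x => c * w x) = c * dot v w.
    by move=> v2; rewrite dotC dotZl// dotC.
  rewrite dot_sqrD ?L2Z// !e1 ?L2Z// dotZl// => h.
  by apply: le_trans h _; lra.
have := dot_ge0 w; rewrite le_eqVlt => /predU1P[ww|ww].
  rewrite -ww mulr0.
  have [->|ne0] := eqVneq (dot u w) 0; first by rewrite expr0n /=.
  have := h (- (dot u u + 1) / (2 * dot u w)); rewrite -ww mulr0 addr0.
  have -> : 2 * (- (dot u u + 1) / (2 * dot u w)) * dot u w = - (dot u u + 1).
    by field.
  by move=> h1; exfalso; lra.
have := h (- dot u w / dot w w).
have -> : dot u u + 2 * (- dot u w / dot w w) * dot u w +
    (- dot u w / dot w w) ^+ 2 * dot w w = dot u u - dot u w ^+ 2 / dot w w.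
  by field; rewrite gt_eqF.
by rewrite subr_ge0 ler_pdivrMr.
Qed.

End L2_inner_product.

(** * Residuals and their energies *)
Section residual.
Context {R : realType} (H : R).
Hypothesis H_gt : 2^-1 < H.
Hypothesis H_lt : H < 1.
Notation mu := (@lebesgue_measure R).
Notation P := (uniform_prob (@ltr01 R)).
Notation alpha := (fbm_alpha H).
Notation K := (fbm_kernel H).
Notation L2 := (Lfun P 2%:E).

Let alpha_gt0 := fbm_alpha_gt0 H_gt.
Let alpha2_lt1 := fbm_alpha2_lt1 H_lt.

Definition kernel_bound (s : R) : R := `|fbm_C H| / alpha * s `^ (- alpha).

Lemma kernel_bound_ge0 s : 0 <= kernel_bound s.
Proof. by rewrite !mulr_ge0 ?powR_ge0// invr_ge0 ltW. Qed.

Lemma kernel_bound_L2 : kernel_bound \in L2.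
Proof.
apply: L2Z; apply: L2P.
  by apply: measurable_powR_comp; exact: measurable_id.
rewrite integral_uniform01//; last 2 first.
- apply/measurable_EFinP; apply: measurable_funX.
  by apply: measurable_powR_comp; exact: measurable_id.
- by move=> s; rewrite lee_fin sqr_ge0.
rewrite (eq_integral (fun s : measurableTypeR R =>
  (((s : R) - 0) `^ ((1 - 2 * alpha) - 1))%:E)); last first.
  move=> s _; rewrite subr0 -powR_mulrn ?powR_ge0// -powRrM; congr (_ `^ _)%:E.
  ring.
apply: (le_lt_trans (integral_powR_shift_le _ _)); rewrite ?ltry//.
by rewrite subr_gt0.
Qed.

(** Hoelder continuity between the times [s], where [K s s = 0], and [t]. *)
Lemma kernel_le (t s : R) : `|K t s| <= kernel_bound s.
Proof.
have [/andP[s0 st]|/fbm_kernel_out ->] := boolP (0 < s < t); last first.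
  by rewrite normr0 kernel_bound_ge0.
have [t1|t1] := leP t 1; last first.
  by rewrite /fbm_kernel s0 st (lt_geF t1)/= normr0 kernel_bound_ge0.
have := @fbm_kernel_holder _ _ H_gt H_lt s t s (ltW s0) (ltW st) t1.
rewrite (@fbm_kernel_out _ _ s s) ?ltxx ?andbF// subr0 => /le_trans; apply.
rewrite -/(kernel_bound s) ler_piMr ?kernel_bound_ge0//.
have -> : 1 = 1 `^ alpha :> R by rewrite powR1.
by have a0 := alpha_gt0; apply: ge0_ler_powR; rewrite ?nnegrE; lra.
Qed.

Lemma measurable_kernel t : measurable_fun setT (K t).
Proof.
apply: (measurableT_comp (measurable_fbm_kernel H_gt H_lt) (g := fun s => (t, s))).
exact: pair1_measurable.
Qed.

Lemma kernel_L2 t : K t \in L2.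
Proof.
apply: (L2_dominated kernel_bound_L2); first exact: measurable_kernel.
by move=> s; rewrite (ger0_norm (kernel_bound_ge0 s)) kernel_le.
Qed.

Definition stopped (x : R -> R) (t s : R) : R := \1_(`[0, t]%classic : set R) s * x s.

(** This is [1_[0,t] (K(t,.) - x)], because [K(t,.)] vanishes outside of
    [[0, t]]. *)
Definition residual (x : R -> R) (t s : R) : R := K t s - stopped x t s.

Lemma stopped_le x t s : `|stopped x t s| <= `|x s|.
Proof. by rewrite /stopped indicE; case: (_ \in _); rewrite ?mul1r// mul0r normr0. Qed.

Lemma stopped_L2 x t : x \in L2 -> stopped x t \in L2.
Proof.
move=> x2; apply: (L2_dominated x2); last exact: stopped_le.
by apply: measurable_funM; [exact: measurable_indic|exact: L2_measurable x2].
Qed.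

Lemma residual_L2 x t : x \in L2 -> residual x t \in L2.
Proof. by move=> x2; apply: L2B; [exact: kernel_L2|exact: stopped_L2]. Qed.

(** A square integrable bound for the residuals at all times. *)
Definition envelope (x : R -> R) (s : R) : R := kernel_bound s + `|x s|.

Lemma envelope_L2 x : x \in L2 -> envelope x \in L2.
Proof.
move=> x2; apply: L2D; first exact: kernel_bound_L2.
apply: (L2_dominated x2) => [|s]; last by rewrite normr_id.
by apply: measurableT_comp => //; exact: L2_measurable x2.
Qed.

Lemma residual_le x t s : `|residual x t s| <= envelope x s.
Proof.
apply: le_trans (ler_normB _ _) _.
by apply: lerD; [exact: kernel_le|exact: stopped_le].
Qed.

Lemma residual_out x t s : s \notin `[0, t] -> residual x t s = 0.
Proof.
move=> st; rewrite /residual /stopped indicE memNset ?mul0r ?subr0; last exact/negP.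
apply: fbm_kernel_out; apply: contra st => /andP[s0 s1].
by rewrite in_itv/= !ltW.
Qed.

Lemma dot_residual_stopped x w t :
  dot P (residual x t) (stopped w t) = dot P (residual x t) w.
Proof.
apply: eq_Rintegral => s _; rewrite /stopped indicE.
have [st|st] := boolP (s \in `[0, t]); last by rewrite residual_out// !mul0r.
by rewrite mem_set ?mul1r.
Qed.

Definition energy x t : R := dot P (residual x t) (residual x t).

Lemma energy_le x t : x \in L2 -> energy x t <= dot P (envelope x) (envelope x).
Proof.
move=> x2; apply: le_Rintegral => //.
- by apply: integrable_L2M; exact: residual_L2.
- by apply: integrable_L2M; exact: envelope_L2.
- move=> s _; rewrite -!expr2 -(real_normK (num_real (residual x t s))).
  by rewrite lerXn2r ?nnegrE ?residual_le// addr_ge0 ?kernel_bound_ge0.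
Qed.

Lemma energyD x w (c : R) t : x \in L2 -> w \in L2 ->
  energy (fun s => x s + c * w s) t =
  energy x t - 2 * c * dot P (residual x t) w +
  c ^+ 2 * dot P (stopped w t) (stopped w t).
Proof.
move=> x2 w2; have rx := residual_L2 t x2; have cw := stopped_L2 t w2.
have e : residual (fun s => x s + c * w s) t =
    (fun s => residual x t s + (- c) * stopped w t s).
  by apply/funext => s; rewrite /residual /stopped; ring.
have e1 u : u \in L2 ->
    dot P u (fun s => (- c) * stopped w t s) = - c * dot P u (stopped w t).
  by move=> u2; rewrite dotC dotZl// dotC.
rewrite /energy e dot_sqrD ?L2Z// !e1 ?L2Z// dotZl// dot_residual_stopped; ring.
Qed.

Lemma dot_stopped_le w t : w \in L2 -> dot P (stopped w t) (stopped w t) <= dot P w w.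
Proof.
move=> w2; apply: le_Rintegral => //.
- by apply: integrable_L2M; exact: stopped_L2.
- exact: integrable_L2M.
- move=> s _; rewrite -!expr2 -(real_normK (num_real (stopped w t s))).
  by rewrite -(real_normK (num_real (w s))) lerXn2r ?nnegrE ?stopped_le.
Qed.

End residual.

(** * Continuity in time *)
Section regularity.
Context {R : realType} (H : R).
Hypothesis H_gt : 2^-1 < H.
Hypothesis H_lt : H < 1.
Notation mu := (@lebesgue_measure R).
Notation P := (uniform_prob (@ltr01 R)).
Notation alpha := (fbm_alpha H).
Notation K := (fbm_kernel H).
Notation L2 := (Lfun P 2%:E).
Notation kb := (kernel_bound H).

Let alpha_gt0 : 0 < alpha := fbm_alpha_gt0 H_gt.

Implicit Types (x w : R -> R) (t : R).

Definition sqr_mass (x : R -> R) (t : R) : R := \int[mu]_(s in `[0, t]) (x s ^+ 2).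

Lemma integrable_sqr_L2 x : x \in L2 -> mu.-integrable `[0, 1] (fun s => (x s ^+ 2)%:E).
Proof.
move=> x2; apply/integrableP; split.
  apply/measurable_EFinP; apply: measurable_funX.
  by apply: measurable_funTS; exact: L2_measurable x2.
have /integrableP[m] := Lfun2_integrable_sqr x2.
rewrite integral_uniform01//.
exact: measurableT_comp.
Qed.

Lemma dot_stoppedE x t : x \in L2 -> t \in `[0, 1] ->
  dot P (stopped x t) (stopped x t) = sqr_mass x t.
Proof.
move=> x2 t01; rewrite /dot /sqr_mass /Rintegral integral_uniform01; last 2 first.
- apply/measurable_EFinP; apply: measurable_funM;
  exact: L2_measurable (stopped_L2 _ x2).
- by move=> s; rewrite lee_fin -expr2 sqr_ge0.
have -> : `[0, t]%classic = `[0, 1]%classic `&` `[0, t]%classic :> set R.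
  rewrite setIidr//; apply: subset_itvl; rewrite bnd_simp.
  by move: t01; rewrite in_itv/= => /andP[].
rewrite integral_mkcondr; congr fine; apply: eq_integral => s _.
rewrite patchE /stopped indicE; case: ifPn => _; last by rewrite !mul0r.
by rewrite !mul1r.
Qed.

(** The increment of the residual is the sum of that of the kernel, controlled by
    the Hoelder estimate, and of [1_]t,t'] x], whose squared norm is the increment
    of [sqr_mass]. *)
Lemma dot_residualB x t (t' : R) :
  x \in L2 -> t \in `[0, 1] -> t' \in `[0, 1] -> t <= t' ->
  dot P (fun s => residual H x t' s - residual H x t s)
        (fun s => residual H x t' s - residual H x t s) <=
  2 * dot P kb kb * (`|t' - t| `^ alpha) ^+ 2 + 2 * `|sqr_mass x t' - sqr_mass x t|.
Proof.
move=> x2 t01 t'01 tt'.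
have [t0 t1] : 0 <= t /\ t <= 1 by move: t01; rewrite in_itv/= => /andP[].
have [t'0 t'1] : 0 <= t' /\ t' <= 1 by move: t'01; rewrite in_itv/= => /andP[].
have dt : `|t' - t| = t' - t by rewrite ger0_norm ?subr_ge0.
pose d := `|t' - t| `^ alpha.
have kb2 : kb \in L2 by exact: kernel_bound_L2.
pose ct s := stopped x t s; pose ct' s := stopped x t' s.
have ct2 : ct \in L2 by exact: stopped_L2.
have ct'2 : ct' \in L2 by exact: stopped_L2.
rewrite -!dot_stoppedE// -/ct -/ct'.
apply: (@le_trans _ _ (2 * (d ^+ 2 * dot P kb kb) +
  2 * (dot P ct' ct' - dot P ct ct))); last first.
  apply: lerD; last by rewrite ler_pM2l// ler_norm.
  by rewrite le_eqVlt; apply/orP; left; apply/eqP; rewrite /d; ring.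
have i1 := integrable_L2M kb2 kb2; have i2 := integrable_L2M ct2 ct2.
have i3 := integrable_L2M ct'2 ct'2.
have i4 : P.-integrable setT (fun s => (d ^+ 2 * (kb s * kb s))%:E).
  by under eq_fun do rewrite EFinM; exact: integrableZl.
have i5 : P.-integrable setT (fun s => (ct' s * ct' s - ct s * ct s)%:E).
  by under eq_fun do rewrite EFinB; exact: integrableB.
have i6 : P.-integrable setT (fun s => (2 * (d ^+ 2 * (kb s * kb s)))%:E).
  by under eq_fun do rewrite EFinM; exact: integrableZl.
have i7 : P.-integrable setT (fun s => (2 * (ct' s * ct' s - ct s * ct s))%:E).
  by under eq_fun do rewrite EFinM; exact: integrableZl.
rewrite /dot -(RintegralZl _ measurableT i1) -(RintegralB measurableT i3 i2).
rewrite -(RintegralZl _ measurableT i4) -(RintegralZl _ measurableT i5).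
rewrite -(RintegralD measurableT i6 i7).
apply: le_Rintegral => //.
- by apply: integrable_L2M; apply: L2B; exact: residual_L2.
- exact: (integrableD measurableT i6 i7).
move=> s _; rewrite -!expr2.
have dK : (K t' s - K t s) ^+ 2 <= (d * kb s) ^+ 2.
  rewrite -(real_normK (num_real (K t' s - K t s))).
  rewrite lerXn2r ?nnegrE ?(mulr_ge0 (powR_ge0 _ _) (kernel_bound_ge0 H_gt _))//.
  have := fbm_kernel_holder H_gt H_lt s t0 tt' t'1.
  by rewrite /d dt -/(kernel_bound H s) mulrC.
have dc : (ct' s - ct s) ^+ 2 = ct' s ^+ 2 - ct s ^+ 2.
  rewrite /ct /ct' /stopped !indicE.
  have [st|st] := boolP (s \in `[0, t]%classic).
    have -> : s \in `[0, t']%classic.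
      by move: st; rewrite !inE/= !in_itv/= => /andP[-> /le_trans]; apply.
    rewrite /=; ring.
  by case: (s \in _); rewrite /= ?mul0r ?mul1r ?subr0 ?expr0n/=; ring.
rewrite -dc.
have -> : residual H x t' s - residual H x t s = (K t' s - K t s) - (ct' s - ct s).
  by rewrite /residual /ct /ct'; ring.
move: (K t' s - K t s) (ct' s - ct s) dK => u v; rewrite exprMn => dK.
have := sqr_ge0 (u + v); have -> : (u + v) ^+ 2 = u ^+ 2 + 2 * u * v + v ^+ 2 by ring.
have -> : (u - v) ^+ 2 = u ^+ 2 - 2 * u * v + v ^+ 2 by ring.
lra.
Qed.

(** Carries the continuity of the residual in L_2([0,1]) over to its inner
    products with fixed functions and to the energy. *)
Lemma within01_continuous (f x : R -> R) (c : R) : x \in L2 -> 0 <= c ->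
  (forall t t', t \in `[0, 1] -> t' \in `[0, 1] -> t <= t' ->
   (f t' - f t) ^+ 2 <= c *
   dot P (fun s => residual H x t' s - residual H x t s)
        (fun s => residual H x t' s - residual H x t s)) ->
  {within `[0, 1], continuous f}.
Proof.
move=> x2 c0 fc.
pose Q := dot P kb kb.
have Q0 : 0 <= Q by exact: dot_ge0.
have fm t t' : t \in `[0, 1] -> t' \in `[0, 1] ->
    (f t' - f t) ^+ 2 <=
    c * (2 * Q * (`|t' - t| `^ alpha) ^+ 2 + 2 * `|sqr_mass x t' - sqr_mass x t|).
  move=> t01 t'01; have [tt'|tt'] := leP t t'.
    by apply: le_trans (fc _ _ t01 t'01 tt') _; rewrite ler_wpM2l// dot_residualB.
  rewrite -(sqrrN (f t' - f t)) opprB (distrC t') (distrC (sqr_mass x t')).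
  apply: le_trans (fc _ _ t'01 t01 (ltW tt')) _.
  by rewrite ler_wpM2l// dot_residualB// ltW.
have cmass : {within `[0, 1], continuous (sqr_mass x)}.
  exact: (parameterized_integral_continuous ler01 (integrable_sqr_L2 x2)).
apply/subspace_continuousP => t t01; apply/cvgrPdist_lt => e e0.
have {}t01 : t \in `[0, 1] by [].
have /subspace_continuousP/(_ t t01)/cvgrPdist_lt cm := cmass.
(* [eta] is such that [c * (2 * Q * eta + 2 * eta) < e ^+ 2] *)
pose eta := e ^+ 2 / (2 * c * (Q + 1) + 2 * c + 1).
have den0 : 0 < 2 * c * (Q + 1) + 2 * c + 1.
  by rewrite ltr_wpDl// addr_ge0// !mulr_ge0// addr_ge0.
have eta0 : 0 < eta by rewrite divr_gt0// exprn_gt0.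
pose r := Num.sqrt eta `^ alpha^-1.
have se0 : 0 < Num.sqrt eta by rewrite sqrtr_gt0.
have r0 : 0 < r by rewrite powR_gt0.
have near1 : \forall t' \near within `[0, 1] (nbhs t), `|t' - t| < r.
  by apply: cvg_within; exists r => //= y; rewrite /ball/= distrC.
near=> t'.
have t'01 : t' \in `[0, 1] by near: t'; exact: withinT.
have h1 : (`|t' - t| `^ alpha) ^+ 2 <= eta.
  rewrite -(sqr_sqrtr (ltW eta0)) lerXn2r ?nnegrE ?powR_ge0 ?(ltW se0)//.
  have -> : Num.sqrt eta = r `^ alpha.
    by rewrite /r -powRrM mulVf ?gt_eqF// powRr1// ltW.
  apply: ge0_ler_powR; rewrite ?nnegrE ?(ltW alpha_gt0) ?(ltW r0)//.
  by apply: ltW; near: t'; exact: near1.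
have h2 : `|sqr_mass x t' - sqr_mass x t| < eta.
  by rewrite distrC; near: t'; exact: cm.
rewrite distrC -(@ltr_pXn2r _ 2)// ?nnegrE ?ltW// real_normK ?num_real//.
apply: le_lt_trans (fm _ _ t01 t'01) _.
apply: (@le_lt_trans _ _ (c * (2 * Q * eta + 2 * eta))).
  rewrite ler_wpM2l// lerD ?ler_wpM2l ?mulr_ge0// ltW//.
have -> : e ^+ 2 = eta * (2 * c * (Q + 1) + 2 * c + 1) by rewrite /eta divfK// gt_eqF.
rewrite -subr_gt0.
have -> : eta * (2 * c * (Q + 1) + 2 * c + 1) - c * (2 * Q * eta + 2 * eta) =
  eta + eta * c * 2 by ring.
by rewrite ltr_pwDl// mulr_ge0// mulr_ge0// (ltW eta0).
Unshelve. all: by end_near.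
Qed.

Lemma continuous_dot_residual x w : x \in L2 -> w \in L2 ->
  {within `[0, 1], continuous (fun t => dot P (residual H x t) w)}.
Proof.
move=> x2 w2; apply: (@within01_continuous _ x (dot P w w)) => //; first exact: dot_ge0.
move=> t t' _ _ _; rewrite -dotBl ?residual_L2// mulrC.
by apply: dot_Cauchy_Schwarz => //; apply: L2B; exact: residual_L2.
Qed.

Lemma continuous_energy x : x \in L2 -> {within `[0, 1], continuous (energy H x)}.
Proof.
move=> x2; pose M := dot P (envelope H x) (envelope H x).
apply: (@within01_continuous _ x (4 * M)) => //.
  by rewrite mulr_ge0 ?dot_ge0.
move=> t t' t01 t'01 tt'.
have r2 t0 : residual H x t0 \in L2 by exact: residual_L2.
pose d s := residual H x t' s - residual H x t s.
pose p s := residual H x t' s + residual H x t s.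
have d2 : d \in L2 by exact: L2B.
have p2 : p \in L2 by exact: L2D.
have -> : energy H x t' - energy H x t = dot P d p.
  have e u : u \in L2 ->
      dot P u p = dot P u (residual H x t') + dot P u (residual H x t).
    by move=> u2; rewrite dotC dotDl// ![dot P _ u]dotC.
  have -> : dot P d p = dot P (residual H x t') p - dot P (residual H x t) p.
    exact: dotBl.
  by rewrite !e// (dotC P (residual H x t)) /energy; ring.
apply: le_trans (dot_Cauchy_Schwarz d2 p2) _; rewrite mulrC ler_wpM2r ?dot_ge0//.
have e1 := energy_le H_gt H_lt t x2; have e2 := energy_le H_gt H_lt t' x2.
apply: le_trans (dot_sqrD_le (r2 t') (r2 t)) _.
by move: e1 e2; rewrite /energy -/M; lra.
Qed.

End regularity.

(** * Self-similarity and the minimization problem in terms of energies *)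
Section energy_scaling.
Context {R : realType} (H : R).
Hypothesis H_gt : 2^-1 < H.
Hypothesis H_lt : H < 1.
Notation mu := (@lebesgue_measure R).
Notation P := (uniform_prob (@ltr01 R)).
Notation alpha := (fbm_alpha H).
Notation K := (fbm_kernel H).
Notation L2 := (Lfun P 2%:E).
Implicit Types (x w : R -> R) (t s c : R).

Lemma integral_uniform_supported (f : R -> \bar R) :
  measurable_fun setT f -> (forall s, 0 <= f s)%E ->
  (forall s, s \notin `[0, 1] -> f s = 0%E) ->
  (\int[P]_s f s = \int[mu]_s f s)%E.
Proof.
move=> mf f0 fout; rewrite integral_uniform01// integral_mkcond.
apply: eq_integral => s _; rewrite patchE; case: ifPn => // s01.
by rewrite fout//; apply: contra s01; rewrite inE.
Qed.

Lemma energyE x t : x \in L2 -> t <= 1 ->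
  (energy H x t)%:E = (\int[mu]_s (residual H x t s ^+ 2)%:E)%E.
Proof.
move=> x2 t1; have r2 := residual_L2 H_gt H_lt t x2.
rewrite -integral_uniform_supported//.
- rewrite /energy /dot fineK//.
  by apply: integrable_fin_num => //; exact: integrable_L2M.
- by apply/measurable_EFinP; apply: measurable_funX; exact: L2_measurable r2.
- by move=> s; rewrite lee_fin sqr_ge0.
- move=> s s01; rewrite residual_out ?expr0n//.
  by apply: contra s01; rewrite !in_itv/= => /andP[-> /le_trans]; apply.
Qed.

Definition rescale c x s : R := c `^ alpha * x (c^-1 * s).

Lemma rescale_L2 c x : 0 < c -> x \in L2 -> (forall s, s \notin `[0, 1] -> x s = 0) ->
  rescale c x \in L2.
Proof.
move=> c0 x2 xout; have mx := L2_measurable x2.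
have mrx : measurable_fun setT (rescale c x).
  apply: measurable_funM => //; apply: (measurableT_comp mx); exact: measurable_funM.
apply: L2P => //; rewrite integral_uniform01; last 2 first.
- by apply/measurable_EFinP; exact: measurable_funX.
- by move=> s; rewrite lee_fin sqr_ge0.
apply: (@le_lt_trans _ _ (\int[mu]_s (rescale c x s ^+ 2)%:E)%E).
  apply: ge0_subset_integral => //.
  - by apply/measurable_EFinP; exact: measurable_funX.
  - by move=> s _; rewrite lee_fin sqr_ge0.
rewrite (ge0_integral_scale c0); last 2 first.
- by apply/measurable_EFinP; exact: measurable_funX.
- by move=> s; rewrite lee_fin sqr_ge0.
rewrite (eq_integral (fun s : measurableTypeR R =>
  ((c `^ alpha) ^+ 2)%:E * (x s ^+ 2)%:E)%E); last first.
  by move=> s _; rewrite /rescale mulKf ?gt_eqF// exprMn EFinM.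
have mx2 : measurable_fun setT (fun s => (x s ^+ 2)%:E).
  by apply/measurable_EFinP; exact: measurable_funX.
rewrite ge0_integralZl//; last 2 first.
- by move=> s _; rewrite lee_fin sqr_ge0.
- by rewrite lee_fin sqr_ge0.
rewrite -integral_uniform_supported//; last 2 first.
- by move=> s; rewrite lee_fin sqr_ge0.
- by move=> s s01; rewrite xout// expr0n.
have /integrable_fin_num h := Lfun2_integrable_sqr x2.
by rewrite -(fineK (h measurableT)) -!EFinM ltry.
Qed.

Lemma residual_rescale c x t s : 0 < c -> c <= 1 -> t <= 1 ->
  residual H (rescale c x) (c * t) (c * s) = c `^ alpha * residual H x t s.
Proof.
move=> c0 c1 t1; rewrite /residual /stopped fbm_kernel_scale// /rescale mulKf ?gt_eqF//.
rewrite !indicE.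
have -> : (c * s \in `[0, c * t]%classic) = (s \in `[0, t]%classic).
  by rewrite !mem_setE !in_itv/= pmulr_rge0// ler_pM2l.
by ring.
Qed.

Lemma energy_rescale c x t : 0 < c -> c <= 1 -> t <= 1 -> x \in L2 ->
  (forall s, s \notin `[0, 1] -> x s = 0) ->
  energy H (rescale c x) (c * t) = c * (c `^ alpha) ^+ 2 * energy H x t.
Proof.
move=> c0 c1 t1 x2 xout; apply: EFin_inj.
have cx2 := rescale_L2 c0 x2 xout.
have ct1 : c * t <= 1 by rewrite (le_trans _ c1)// ger_pMr.
rewrite energyE// (ge0_integral_scale c0); last 2 first.
- apply/measurable_EFinP; apply: measurable_funX.
  exact: L2_measurable (residual_L2 H_gt H_lt _ cx2).
- by move=> s; rewrite lee_fin sqr_ge0.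
rewrite (eq_integral (fun s : measurableTypeR R =>
  ((c `^ alpha) ^+ 2)%:E * (residual H x t s ^+ 2)%:E)%E); last first.
  by move=> s _; rewrite residual_rescale// exprMn EFinM.
rewrite ge0_integralZl//; last 3 first.
- apply/measurable_EFinP; apply: measurable_funX.
  exact: L2_measurable (residual_L2 H_gt H_lt _ x2).
- by move=> s _; rewrite lee_fin sqr_ge0.
- by rewrite lee_fin sqr_ge0.
by rewrite -energyE// !EFinM muleA.
Qed.

Lemma fbm_gE x t : x \in L2 -> t \in `[0, 1] ->
  fbm_g H x t = (Num.sqrt (energy H x t))%:E.
Proof.
move=> x2 t01; rewrite -[RHS]/(sqrte (energy H x t)%:E) energyE//; last first.
  by move: t01; rewrite in_itv/= => /andP[].
rewrite /fbm_g integral_mkcond; congr sqrte; apply: eq_integral => s _.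
rewrite patchE; case: ifPn => st.
  by rewrite /residual /stopped indicE st mul1r.
by rewrite residual_out ?expr0n//; apply: contra st; rewrite inE.
Qed.

Lemma L2_01_L2 x : x \in L2 -> L2_01 x.
Proof.
move=> x2; split; first by apply: measurable_funTS; exact: L2_measurable x2.
have /integrableP[m h] := integrable_sqr_L2 x2.
apply: le_lt_trans h; rewrite le_eqVlt; apply/orP; left; apply/eqP.
by apply: eq_integral => s _; rewrite /= ger0_norm// sqr_ge0.
Qed.

Lemma L2_01_patch x : L2_01 x -> x \_ `[0, 1] \in L2.
Proof.
move=> [mx xi]; have mx0 : measurable_fun setT (x \_ `[0, 1]).
  by apply/(measurable_restrictT _ _).1.
apply: L2P => //; rewrite integral_uniform01; last 2 first.
- by apply/measurable_EFinP; exact: measurable_funX.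
- by move=> s; rewrite lee_fin sqr_ge0.
apply: le_lt_trans xi; rewrite le_eqVlt; apply/orP; left; apply/eqP.
by apply: eq_integral => s s01; rewrite patchE s01.
Qed.

Lemma fbm_g_patch x t : t \in `[0, 1] -> fbm_g H (x \_ `[0, 1]) t = fbm_g H x t.
Proof.
rewrite in_itv/= => /andP[t0 t1]; rewrite /fbm_g; congr sqrte.
apply: eq_integral => s; rewrite inE/= in_itv/= => /andP[s0 st].
by rewrite patchE mem_set//= in_itv/= s0 (le_trans st).
Qed.

(** The three properties of a minimizer that the rest of the proof relies on;
    [min_energy] is the square of the minimum of the functional.  Replacing [a]
    by 0 outside of [[0, 1]] makes it measurable on the whole line. *)
Lemma minimizerP a : fbm_minimizer H a -> let a0 := a \_ `[0, 1] in
  exists min_energy : R,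
  [/\ forall t, t \in `[0, 1] -> energy H a0 t <= min_energy,
      forall x M, x \in L2 -> (forall t, t \in `[0, 1] -> energy H x t <= M) ->
        min_energy <= M &
      forall t, t \in `[0, 1] -> energy H a0 t = min_energy -> fbm_G H a t].
Proof.
move=> [a2 amin] a0.
have a02 : a0 \in L2 by exact: L2_01_patch.
have fE : fbm_f H a = ereal_sup [set fbm_g H a0 t | t in `[0, 1]].
  congr ereal_sup; apply/seteqP; split => y /= [t t01 <-]; exists t => //;
  by rewrite fbm_g_patch.
have f_le x M : x \in L2 -> (forall t, t \in `[0, 1] -> energy H x t <= M) ->
    (fbm_f H a <= (Num.sqrt M)%:E)%E.
  move=> x2 xM; apply: le_trans (amin x (L2_01_L2 x2)) _.
  apply: ge_ereal_sup => _ [t t01 <-]; rewrite fbm_gE// lee_fin ler_wsqrtr//.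
  exact: xM.
have g_le t : t \in `[0, 1] -> ((Num.sqrt (energy H a0 t))%:E <= fbm_f H a)%E.
  move=> t01; rewrite fE; apply: ereal_sup_ubound => /=; exists t => //.
  by rewrite fbm_gE.
have in01 : 0 \in `[(0:R), 1] by rewrite in_itv/= lexx ler01.
have f_fin : fbm_f H a \is a fin_num.
  rewrite fin_numE; apply/andP; split.
    by apply: contraTneq (g_le _ in01) => ->; rewrite -ltNge ltNyr.
  have := @f_le _ (dot P (envelope H a0) (envelope H a0)) a02
    (fun t _ => energy_le H_gt H_lt t a02).
  by move=> /le_lt_trans/(_ (ltry _)); rewrite lt_neqAle => /andP[].
have fK := fineK f_fin; set F := fine _ in fK.
have F0 : 0 <= F by rewrite -lee_fin fK (le_trans _ (g_le _ in01))// lee_fin sqrtr_ge0.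
exists (F ^+ 2); split.
- move=> t t01; have := g_le t t01; rewrite -fK lee_fin.
  have e0 : 0 <= energy H a0 t by exact: dot_ge0.
  move=> eF; rewrite -(sqr_sqrtr e0) lerXn2r ?nnegrE ?sqrtr_ge0//.
- move=> x M x2 xM; have := f_le x M x2 xM; rewrite -fK lee_fin => FM.
  have M0 : 0 <= M by apply: le_trans (xM _ in01); exact: dot_ge0.
  by rewrite -(sqr_sqrtr M0) lerXn2r ?nnegrE ?sqrtr_ge0.
- move=> t t01 e; split => //.
  by rewrite -fbm_g_patch// fbm_gE// e sqrtr_sqr ger0_norm.
Qed.

End energy_scaling.

(** * Optimality and approachability *)
Section optimality.
Context {R : realType} (H : R).
Hypothesis H_gt : 2^-1 < H.
Hypothesis H_lt : H < 1.
Notation mu := (@lebesgue_measure R).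
Notation P := (uniform_prob (@ltr01 R)).
Notation alpha := (fbm_alpha H).
Notation K := (fbm_kernel H).
Notation L2 := (Lfun P 2%:E).
Implicit Types (x w : R -> R) (t s : R).

Variables (a : R -> R) (min_energy : R).
Hypothesis a2 : a \in L2.
Hypothesis energy_max : forall t, t \in `[0, 1] -> energy H a t <= min_energy.
Hypothesis energy_min : forall x (M : R), x \in L2 ->
  (forall t, t \in `[0, 1] -> energy H x t <= M) -> min_energy <= M.

Notation r := (residual H a).
Let r2 t : r t \in L2 := residual_L2 H_gt H_lt t a2.

Definition active : set R := [set t | t \in `[0, 1] /\ energy H a t = min_energy].

Lemma min_energy_ge0 : 0 <= min_energy.
Proof.
apply: le_trans (energy_max (_ : 1 \in `[0, 1])); last first.
  by rewrite in_itv/= lexx ler01.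
exact: dot_ge0.
Qed.

Lemma energyD_le x w (c : R) t : x \in L2 -> w \in L2 ->
  energy H (fun s => x s + c * w s) t <=
  energy H x t - 2 * c * dot P (residual H x t) w + c ^+ 2 * dot P w w.
Proof.
by move=> x2 w2; rewrite energyD// lerD2l ler_wpM2l ?sqr_ge0 ?dot_stopped_le.
Qed.

(** Convexity: the energy lies above its tangents. *)
Lemma energyD_ge x w t : x \in L2 -> w \in L2 ->
  energy H x t - 2 * dot P (residual H x t) w <= energy H (fun s => x s + w s) t.
Proof.
move=> x2 w2; have -> : (fun s => x s + w s) = (fun s => x s + 1 * w s).
  by apply/funext => s; rewrite mul1r.
by rewrite energyD// mulr1 lerDl mulr_ge0 ?sqr_ge0 ?dot_ge0.
Qed.

(** The continuous function [f] below is nonnegative and vanishes only at active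
    times with [g t <= 0].  If its minimum on [[0, 1]] were positive, each time
    would either have [energy H a t <= min_energy - eta] or [eta <= g t] for some
    [eta > 0], and all the energies of [a + e w] would be at most
    [min_energy - e * eta] for a small [e > 0]. *)
Lemma exists_descent w : w \in L2 -> exists2 t, active t & dot P (r t) w <= 0.
Proof.
move=> w2; pose g t := dot P (r t) w.
pose f t := (min_energy - energy H a t) + (`|g t| + g t).
have cg : {within `[0, 1], continuous g} by exact: continuous_dot_residual.
have ce : {within `[0, 1], continuous (energy H a)} by exact: continuous_energy.
have cf : {within `[0, 1], continuous f}.
  move=> t; apply: cvgD; first by apply: cvgB; [exact: cvg_cst|exact: ce].
  by apply: cvgD; [apply: cvg_norm; exact: cg|exact: cg].
have [t0 t001 t0min] := EVT_min ler01 cf.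
have gg t : 0 <= `|g t| + g t by rewrite -lerBlDr sub0r ler_normr lexx orbT.
have [ft0|ft0] := leP (f t0) 0.
  have e0 := energy_max t001; have g0 := gg t0.
  move: ft0; rewrite /f => ft0; exists t0; first by split => //; lra.
  have : `|g t0| + g t0 <= 0 by lra.
  by have := normr_ge0 (g t0); rewrite -/(g t0); lra.
exfalso; pose W := dot P w w; pose eta := f t0 / 3.
have W0 : 0 <= W by exact: dot_ge0.
have eta0 : 0 < eta by rewrite /eta; lra.
have min0 := min_energy_ge0.
(* the conditions on the step [e] are [e * (min_energy + 2 * W) <= eta / 2] and
   [e * W <= eta / 2], with [W] the squared norm of [w] *)
pose D := 2 * (min_energy + 2 * W + eta + 1).
have D0 : 0 < D by rewrite /D; lra.
pose e := eta / D.
have e0 : 0 < e by rewrite divr_gt0.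
have eD : e * D = eta by rewrite /e divfK// gt_eqF.
have eF : 0 <= e * min_energy by rewrite mulr_ge0// ltW.
have eW : 0 <= e * W by rewrite mulr_ge0// ltW.
have ee : 0 < e * eta by rewrite mulr_gt0.
have eE : 2 * (e * min_energy) + 4 * (e * W) + 2 * (e * eta) + 2 * e = eta.
  by apply: etrans eD; rewrite /D; ring.
have e1 : e <= 1 by nra.
have eeW : e ^+ 2 * W <= e * W.
  by rewrite expr2 -mulrA ler_piMl.
have eeW2 : e ^+ 2 * W = e * (e * W) by ring.
have : min_energy <= min_energy - e * eta.
  apply: (@energy_min (fun s => a s + e * w s)); first by apply: L2D => //; exact: L2Z.
  move=> t t01; apply: le_trans (energyD_le e t a2 w2) _; rewrite -/(g t) -/W.
  have ht := energy_max t01; have ft := t0min t t01.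
  have rw : 0 <= energy H a t + 2 * g t + W.
    by rewrite -dot_sqrD//; exact: dot_ge0.
  have ft3 : 3 * eta <= min_energy - energy H a t + (`|g t| + g t).
    by apply: le_trans ft; rewrite /eta; lra.
  have [ge|ge] := leP eta (g t).
    have : e * eta <= e * g t by rewrite ler_pM2l.
    have : e * (e * W) <= e * eta by rewrite ler_pM2l//; lra.
    by rewrite eeW2; lra.
  have ht' : energy H a t <= min_energy - eta.
    have [g0|g0] := leP 0 (g t).
      by rewrite ger0_norm// in ft3; lra.
    by rewrite ltr0_norm// in ft3; lra.
  have : e * (- 2 * g t) <= e * (min_energy + W) by rewrite ler_pM2l//; lra.
  by lra.
lra.
Qed.

(** [S n] is the sum of the residuals at the first [n] times; the next time is
    chosen so that the cross term in [|S n + r|^2] is nonpositive. *)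
Lemma approachability : exists2 t : nat -> R, (forall i, active (t i)) &
  forall n w, w \in L2 ->
    (\sum_(i < n) dot P (r (t i)) w) ^+ 2 <= n%:R * min_energy * dot P w w.
Proof.
have /choice[tf tfP] : forall w, exists t, w \in L2 -> active t /\ dot P (r t) w <= 0.
  move=> w; have [w2|w2] := boolP (w \in L2); last by exists 0.
  by have [t ? ?] := exists_descent w2; exists t.
pose S := fix S n : R -> R :=
  if n is m.+1 then fun s => S m s + r (tf (S m)) s else fun=> 0.
have S2 n : S n \in L2.
  elim: n => [|n IH] /=; first exact: (Lfun_cst P 0 2).
  by apply: L2D.
have dS n w : w \in L2 -> dot P (S n) w = \sum_(i < n) dot P (r (tf (S i))) w.
  move=> w2; elim: n => [|n IH].
    rewrite big_ord0 /dot; under eq_Rintegral do rewrite mul0r.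
    by rewrite Rintegral_cst//= mul0r.
  by rewrite big_ord_recr/= -IH dotDl.
have nS n : dot P (S n) (S n) <= n%:R * min_energy.
  elim: n => [|n IH].
    rewrite dS// big_ord0 mul0r//.
  have [[t01 te] tw] := tfP _ (S2 n).
  rewrite /= dot_sqrD// -/S dotC -natr1 mulrDl mul1r.
  rewrite -[X in _ + X <= _]/(energy H a _) te.
  by lra.
exists (fun i => tf (S i)); first by move=> i; have [] := tfP _ (S2 i).
move=> n w w2; rewrite -dS//; apply: le_trans (dot_Cauchy_Schwarz (S2 n) w2) _.
by rewrite ler_wpM2r ?dot_ge0.
Qed.

Lemma closed_active : closed active.
Proof.
move=> p clp.
have p01 : p \in `[0, 1].
  have : closure (`[0, 1] : set R) p by apply: closure_subset clp => t [].
  have cl01 : closed (`[0, 1] : set R) by exact: itv_closed.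
  by rewrite -((closure_id _).1 cl01).
split => //; apply/eqP/negPn/negP => pF.
have /subspace_continuousP/(_ p p01) := continuous_energy H_gt H_lt a2.
move=> /(_ [set y | y != min_energy]) cp.
have /cp : nbhs (energy H a p) [set y | y != min_energy].
  by apply: open_nbhs_nbhs; split => //; exact: open_neq.
move=> /clp[y [[y01 yF]]] hy.
by have /eqP := hy y01; apply; exact: yF.
Qed.

(** By approachability the averages of [dot P (r (t i)) w] tend to 0; along a
    subsequence they also tend to the mean under the limit law. *)
Lemma stationarity : exists2 xi : R -> R,
  {homo xi : u v / u <= v} /\ (forall u, active (xi u)) &
  forall w, w \in L2 -> \int[P]_u dot P (r (xi u)) w = 0.
Proof.
have [t tact tS] := approachability.
have act01 : active `<=` `[0, 1] by move=> u [].
have [xi xiP [k kge kP]] := weak_compactness closed_active act01 tact.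
exists xi => // w w2.
have := kP _ (continuous_dot_residual H_gt H_lt a2 w2).
set I := \int[P]_u _ => cI.
suff c0 : (k m).+1%:R^-1 * \sum_(i < (k m).+1) dot P (r (t i)) w @[m --> \oo] --> (0:R).
  exact: (cvg_unique _ cI c0).
apply/cvgrPdist_lt => e e0.
pose C := min_energy * dot P w w.
have C0 : 0 <= C by rewrite mulr_ge0 ?min_energy_ge0 ?dot_ge0.
pose e' := e ^+ 2 / (C + 1).
have e'0 : 0 < e' by rewrite divr_gt0 ?exprn_gt0// ltr_wpDl.
near=> m.
rewrite sub0r normrN -(@ltr_pXn2r _ 2)// ?nnegrE ?ltW// real_normK ?num_real//.
rewrite exprMn.
have N0 : 0 < (k m).+1%:R :> R by [].
apply: (@le_lt_trans _ _ ((k m).+1%:R^-1 ^+ 2 * ((k m).+1%:R * min_energy * dot P w w))).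
  by rewrite ler_wpM2l ?sqr_ge0// tS.
have -> : (k m).+1%:R^-1 ^+ 2 * ((k m).+1%:R * min_energy * dot P w w) = C / (k m).+1%:R.
  by rewrite /C; field; rewrite gt_eqF.
have km : (k m).+1%:R^-1 < e'.
  apply: (@le_lt_trans _ _ m.+1%:R^-1).
    by rewrite lef_pV2 ?posrE// ler_nat ltnS.
  by near: m; exact: (near_infty_natSinv_lt (PosNum e'0)).
have -> : e ^+ 2 = (C + 1) * e' by rewrite /e' mulrC divfK// gt_eqF// ltr_wpDl.
rewrite mulrDl mul1r (@le_lt_trans _ _ (C * e'))// ?ltrDl// ler_wpM2l// ltW.
Unshelve. all: by end_near.
Qed.

End optimality.

(** * The mean residual under the limit law *)
Section limit_law.
Context {R : realType} (H : R).
Hypothesis H_gt : 2^-1 < H.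
Hypothesis H_lt : H < 1.
Notation mu := (@lebesgue_measure R).
Notation P := (uniform_prob (@ltr01 R)).
Notation alpha := (fbm_alpha H).
Notation K := (fbm_kernel H).
Notation L2 := (Lfun P 2%:E).
Implicit Types (x w : R -> R) (t s u : R).

Lemma integral_uniform_cst (c : R) : (\int[P]_u c%:E = c%:E)%E.
Proof.
transitivity (c%:E * P setT)%E; first exact: (integral_cst P measurableT).
have -> : P setT = 1%E by exact: probability_setT.
exact: mule1.
Qed.

Lemma Rintegral_uniform_cst (c : R) : \int[P]_u c = c.
Proof. by rewrite /Rintegral integral_uniform_cst. Qed.

Lemma dot_eq0 x : x \in L2 -> dot P x x = 0 -> {ae P, forall s, x s = 0}.
Proof.
move=> x2 x0; have ixx := integrable_L2M x2 x2.
have xx0 : (\int[P]_s `|(x s * x s)%:E| = 0)%E.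
  transitivity ((dot P x x)%:E); last by rewrite x0.
  rewrite /dot fineK; last exact: integrable_fin_num.
  by apply: eq_integral => s _; rewrite gee0_abs// lee_fin -expr2 sqr_ge0.
have := (ae_eq_integral_abs P measurableT (measurable_int P ixx)).1 xx0.
apply: (@filterS _ _ (@ae_filter_ringOfSetsType _ _ _ P)) => s /(_ I)/= [] /eqP.
by rewrite mulf_eq0 orbb => /eqP.
Qed.

Variables (a xi : R -> R).
Hypothesis a2 : a \in L2.
Hypothesis xi_nd : {homo xi : u v / u <= v}.
Notation r := (residual H a).
Let r2 t : r t \in L2 := residual_L2 H_gt H_lt t a2.

Let mxi : measurable_fun setT xi.
Proof. exact: nondecreasing_measurable. Qed.

Lemma measurable_residual :
  measurable_fun [set: R * R] (fun z : R * R => r (xi z.1) z.2).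
Proof.
have m1 : measurable_fun [set: R * R] (fun z : R * R => xi z.1).
  by apply: measurableT_comp => //; exact: mxi.
apply: measurable_funB.
  apply: (measurableT_comp (measurable_fbm_kernel H_gt H_lt)
    (g := fun z : R * R => (xi z.1, z.2))).
  exact: measurable_fun_pair.
apply: measurable_funM; last first.
  by apply: measurableT_comp => //; exact: L2_measurable a2.
rewrite (_ : (fun _ => _) = fun z : R * R =>
  if (0 <= z.2) && (z.2 <= xi z.1) then 1 else 0); last first.
  by apply/funext => z; rewrite indicE mem_setE in_itv/=; case: ifPn.
apply: measurable_fun_ifT => //.
by apply: measurable_and; exact: measurable_fun_ler.
Qed.

Let mr s : measurable_fun setT (fun u => r (xi u) s).
Proof.
apply: (measurableT_comp measurable_residual (g := fun u => (u, s))).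
exact: pair2_measurable.
Qed.

Let env_ge0 s : 0 <= envelope H a s.
Proof. by rewrite addr_ge0// kernel_bound_ge0. Qed.

Lemma integrable_residual s : P.-integrable setT (fun u => (r (xi u) s)%:E).
Proof.
apply: (@le_integrable _ _ _ _ _ measurableT _ (cst (envelope H a s)%:E)).
- by apply/measurable_EFinP; exact: mr.
- by move=> u _; rewrite lee_fin (ger0_norm (env_ge0 s)) residual_le.
- exact: (finite_measure_integrable_cst P).
Qed.

Definition mean_residual s : R := \int[P]_u r (xi u) s.

Lemma mean_residual_le s : `|mean_residual s| <= envelope H a s.
Proof.
apply: le_trans (le_normr_Rintegral measurableT (integrable_residual s)) _.
rewrite -(Rintegral_uniform_cst (envelope H a s)).
apply: le_Rintegral => //.
- apply: (integrable_norm (integrable_residual s)).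
- exact: (finite_measure_integrable_cst P).
- by move=> u _; exact: residual_le.
Qed.

Lemma mean_residual_L2 : mean_residual \in L2.
Proof.
apply: (L2_dominated (envelope_L2 H_lt a2)) => [|s]; last first.
  by rewrite (ger0_norm (env_ge0 s)) mean_residual_le.
apply: (measurableT_comp (fine_measurable measurableT)).
apply: (@measurable_fubini_G _ _ _ _ _ P P (fun z : R * R => (r (xi z.1) z.2)%:E)).
apply/integrable21ltyP; first by apply/measurable_EFinP; exact: measurable_residual.
have /integrableP[_] := (Lfun1_integrable P (envelope H a)).1
  (Lfun_subset12 (fin_num_measure P _ measurableT) (envelope_L2 H_lt a2)).
apply: le_lt_trans; apply: ge0_le_integral => //.
- by move=> s _; apply: integral_ge0.
- apply: (@measurable_fun_fubini_tonelli_G _ _ _ _ _ P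
    (fun z : R * R => `|(r (xi z.1) z.2)%:E|)%E) => //.
  by apply: measurableT_comp => //; apply/measurable_EFinP; exact: measurable_residual.
- apply: measurableT_comp => //; apply/measurable_EFinP.
  exact: L2_measurable (envelope_L2 H_lt a2).
move=> s _; rewrite /= ger0_norm// -integral_uniform_cst.
apply: ge0_le_integral => //.
- by apply/measurable_EFinP; apply: measurableT_comp => //; exact: mr.
- by move=> u _; rewrite lee_fin residual_le.
Qed.

Hypothesis xi_stationary : forall w,
  w \in L2 -> \int[P]_u dot P (r (xi u)) w = 0.

(** Stationarity in the direction of the mean residual itself, with the order of
    integration exchanged, says that its norm is 0. *)
Lemma mean_residual_eq0 : {ae P, forall s, mean_residual s = 0}.
Proof.
have V2 := mean_residual_L2; apply: dot_eq0 => //.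
apply: etrans (xi_stationary V2); rewrite /dot.
have mf : measurable_fun [set: R * R]
    (fun z : R * R => (r (xi z.1) z.2 * mean_residual z.2)%:E).
  apply/measurable_EFinP; apply: measurable_funM; first exact: measurable_residual.
  by apply: measurableT_comp => //; exact: L2_measurable V2.
have intf : (P \x P)%E.-integrable [set: R * R]
    (fun z : R * R => (r (xi z.1) z.2 * mean_residual z.2)%:E).
  apply/integrable21ltyP => //.
  have E2 := envelope_L2 H_lt a2.
  have /integrableP[_] := integrable_L2M E2 E2.
  apply: le_lt_trans; apply: ge0_le_integral => //.
  - by move=> s _; apply: integral_ge0.
  - apply: (@measurable_fun_fubini_tonelli_G _ _ _ _ _ P
      (fun z : R * R => `|(r (xi z.1) z.2 * mean_residual z.2)%:E|)%E) => //.
    exact: measurableT_comp.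
  - apply: measurableT_comp => //; apply/measurable_EFinP.
    by apply: measurable_funM; exact: L2_measurable E2.
  move=> s _; pose E := envelope H a s.
  rewrite /= ger0_norm ?mulr_ge0// -integral_uniform_cst.
  apply: ge0_le_integral => //.
  - apply/measurable_EFinP; apply: measurableT_comp => //.
    by apply: measurable_funM => //; exact: mr.
  - move=> u _; rewrite lee_fin normrM ler_pM// ?residual_le// mean_residual_le//.
have fub := Fubini intf; rewrite /= in fub.
have e1 : (\int[P]_u (dot P (r (xi u)) mean_residual)%:E =
    \int[P]_u \int[P]_s (r (xi u) s * mean_residual s)%:E)%E.
  apply: eq_integral => u _; apply: fineK.
  exact: (integrable_fin_num measurableT (integrable_L2M (r2 (xi u)) V2)).
have e2 : (\int[P]_s (mean_residual s * mean_residual s)%:E =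
    \int[P]_s \int[P]_u (r (xi u) s * mean_residual s)%:E)%E.
  apply: eq_integral => s _; pose m := mean_residual s.
  have im : P.-integrable setT (fun u => (r (xi u) s * m)%:E).
    under eq_fun do rewrite EFinM.
    exact: (integrableZr measurableT m (integrable_residual s)).
  transitivity ((\int[P]_u (r (xi u) s * m))%:E).
    congr EFin; apply: esym.
    exact: (@RintegralZr _ _ _ P setT (fun u => r (xi u) s) m measurableT
      (integrable_residual s)).
  exact: (fineK (integrable_fin_num measurableT im)).
by rewrite {1}/Rintegral e2 -fub -e1.
Qed.

End limit_law.

(** * The limit law charges every neighbourhood of 1 *)
Section charge_near_one.
Context {R : realType} (H : R).
Hypothesis H_gt : 2^-1 < H.
Hypothesis H_lt : H < 1.
Notation P := (uniform_prob (@ltr01 R)).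
Notation alpha := (fbm_alpha H).
Notation L2 := (Lfun P 2%:E).
Implicit Types (x w : R -> R) (t s u : R).

Variables (a : R -> R) (min_energy : R).
Hypothesis a2 : a \in L2.
Hypothesis a_out : forall s, s \notin `[0, 1] -> a s = 0.
Hypothesis energy_max : forall t, t \in `[0, 1] -> energy H a t <= min_energy.
Hypothesis min_energy_gt0 : 0 < min_energy.
Variable xi : R -> R.
Hypothesis xi_nd : {homo xi : u v / u <= v}.
Hypothesis xi_active : forall u, active H a min_energy (xi u).
Hypothesis xi_stationary : forall w,
  w \in L2 -> \int[P]_u dot P (residual H a (xi u)) w = 0.

Lemma integrable_dot_residual w : w \in L2 ->
  P.-integrable setT (fun u => (dot P (residual H a (xi u)) w)%:E).
Proof.
move=> w2; pose g t := dot P (residual H a t) w.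
have cg : {within `[0, 1], continuous g} by exact: continuous_dot_residual.
have mg : measurable_fun (`[0, 1] : set R) g by exact: subspace_continuous_measurable_fun.
apply: (@le_integrable _ _ _ _ _ measurableT _ (cst (min_energy + dot P w w)%:E)).
- apply/measurable_EFinP; apply: (measurable_comp _ _ mg) => //.
    by move=> _ [u _ <-]; have [] := xi_active u.
  exact: nondecreasing_measurable.
- move=> u _; rewrite lee_fin -/(g (xi u)); have [t01 te] := xi_active u.
  rewrite (ger0_norm (addr_ge0 (ltW min_energy_gt0) (dot_ge0 P w))).
  have r2 := residual_L2 H_gt H_lt (xi u) a2.
  have := dot_Cauchy_Schwarz r2 w2; rewrite -/(g (xi u)).
  rewrite -[dot P (residual _ _ _) _]/(energy H a (xi u)) te.
  have := dot_ge0 P w; move: (dot P w w) (g (xi u)) => W y W0 yW.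
  have min0 := ltW min_energy_gt0.
  have : `|y| ^+ 2 <= (min_energy + W) ^+ 2.
    by rewrite real_normK ?num_real//; apply: le_trans yW _; nra.
  by rewrite ler_pXn2r// ?nnegrE ?addr_ge0.
- exact: (finite_measure_integrable_cst P).
Qed.

(** Otherwise [xi < c] almost surely for [c] the maximum of [s] and 1/2.  With
    [x] the rescaling of [a] by [c], convexity bounds the inner product of
    [x - a] with the residual of [a] at [xi] from below by a constant [b > 0],
    although its mean is 0. *)
Lemma active_tail_gt0 s : s < 1 -> (0 < P [set u | (s <= xi u)%R])%E.
Proof.
move=> s1; set N := [set u | _].
have mN : measurable N.
  rewrite (_ : N = xi @^-1` `[s, +oo[); last first.
    by apply/seteqP; split => u; rewrite /N/= in_itv/= andbT.
  rewrite -[X in measurable X]setTI.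
  by apply: nondecreasing_measurable.
rewrite lt_neqAle measure_ge0 andbT eq_sym; apply/eqP => N0.
pose c := Num.max s 2^-1.
have c0 : 0 < c by rewrite lt_max invr_gt0 ltr0n orbT.
have c1 : c < 1 by rewrite gt_max s1/=; lra.
have sc : s <= c by rewrite le_max lexx.
pose kappa := c * (c `^ alpha) ^+ 2.
have ca1 : c `^ alpha <= 1.
  have -> : 1 = 1 `^ alpha :> R by rewrite powR1.
  by apply: ge0_ler_powR; rewrite ?nnegrE ?ltW// fbm_alpha_gt0.
have k1 : kappa < 1.
  apply: le_lt_trans c1; rewrite /kappa ler_piMr ?(ltW c0)//.
  by rewrite expr_le1// powR_ge0.
pose x := rescale H c a; pose w s := x s + (-1) * a s.
have x2 : x \in L2 by exact: rescale_L2.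
have w2 : w \in L2 by apply: L2D => //; exact: L2Z.
pose g t := dot P (residual H a t) w.
pose b := (1 - kappa) * min_energy / 2.
have b0 : 0 < b by rewrite divr_gt0// mulr_gt0// subr_gt0.
have gb u : ~ N u -> b <= g (xi u).
  move=> /negP; rewrite -ltNge => xis; have [t01 te] := xi_active u.
  have := energyD_ge H_gt H_lt (xi u) a2 w2.
  rewrite -/(g _) (_ : (fun s => a s + w s) = x); last first.
    by apply/funext => z; rewrite /w; ring.
  have [t0 t1] : 0 <= xi u /\ xi u <= 1 by move: t01; rewrite in_itv/= => /andP[].
  have tc1 : xi u / c <= 1 by rewrite ler_pdivrMr// mul1r (le_trans (ltW xis)).
  have tc01 : xi u / c \in `[0, 1] by rewrite in_itv/= tc1 divr_ge0// ltW.
  have xiE : xi u = c * (xi u / c) by rewrite mulrCA divff ?mulr1// gt_eqF.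
  rewrite te [in X in _ <= X -> _]xiE /x energy_rescale// ?(ltW c1)// -/kappa => h.
  have : kappa * energy H a (xi u / c) <= kappa * min_energy.
    by rewrite ler_wpM2l ?energy_max// mulr_ge0 ?sqr_ge0// ltW.
  by rewrite /b; lra.
have ig := integrable_dot_residual w2.
have g0 := xi_stationary w2.
have : b <= \int[P]_u g (xi u); last by rewrite g0; lra.
rewrite /Rintegral (@negligible_integral _ _ _ P setT N _ mN measurableT ig N0) setTD.
have mNC : measurable (~` N) by exact: measurableC.
have PNC : fine (P (~` N)) = 1.
  transitivity (fine (1 - P N)%E); last by rewrite N0 sube0.
  by congr fine; exact: probability_setC.
have -> : b = \int[P]_(u in ~` N) b.
  by rewrite (Rintegral_cst P mNC b) PNC mulr1.
apply: le_Rintegral => //.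
- exact: (finite_measure_integrable_cst P).
- by apply: integrableS ig.
Qed.

End charge_near_one.

(** * The conditional expectation *)
Section conclusion.
Context {R : realType} (H : R).
Hypothesis H_gt : 2^-1 < H.
Hypothesis H_lt : H < 1.
Notation mu := (@lebesgue_measure R).
Notation P := (uniform_prob (@ltr01 R)).
Notation L2 := (Lfun P 2%:E).

Lemma ae_uniform01 (Q : R -> Prop) : {ae P, forall s, Q s} ->
  {ae mu, forall s, s \in `[0, 1] -> s < 1 /\ Q s}.
Proof.
move=> [N [mN N0 QN]]; exists ((N `&` `[0, 1[) `|` [set 1]); split.
- by apply: measurableU => //; exact: measurableI.
- apply: null_set_setU => //; first exact: measurableI.
    by apply: etrans N0; apply: esym; exact: uniform_prob01E.
  exact: lebesgue_measure_set1.
- move=> s /= nQ; have [s1|s1] := eqVneq s 1; [by right|left].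
  have [s01|] := boolP (s \in `[0, 1]); last first.
    by move=> h; exfalso; apply: nQ => h'; rewrite h' in h.
  move: (s01); rewrite in_itv/= => /andP[s0 sle1].
  have slt1 : s < 1 by rewrite lt_neqAle s1.
  split; last by rewrite /= in_itv/= s0.
  by apply: QN => /= Qs; apply: nQ => _.
Qed.

Lemma conditional_mean (a xi : R -> R) (s : R) : a \in L2 ->
  {homo xi : u v / u <= v} -> 0 <= s -> (0 < P [set u | (s <= xi u)%R])%E ->
  mean_residual H a xi s = 0 ->
  (a s)%:E = cond_expectation P (fun u => fbm_kernel H (xi u) s) [set u | (s <= xi u)%R].
Proof.
move=> a2 xi_nd s0; set A := [set u | _] => PA V0.
have mA : measurable A.
  rewrite (_ : A = xi @^-1` `[s, +oo[); last first.
    by apply/seteqP; split => u; rewrite /A/= in_itv/= andbT.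
  rewrite -[X in measurable X]setTI.
  by apply: nondecreasing_measurable.
have PAfin : P A \is a fin_num by exact: fin_num_measure.
pose p := fine (P A).
have pE : P A = p%:E by rewrite fineK.
have p0 : 0 < p by rewrite -lte_fin -pE.
pose k u := fbm_kernel H (xi u) s.
have iA : P.-integrable setT (fun u => (a s * \1_A u)%:E).
  under eq_fun do rewrite EFinM.
  exact: (integrableZl measurableT (a s) (@integrable_indic _ _ _ P A mA)).
have kE : k = (fun u => residual H a (xi u) s + a s * \1_A u).
  apply/funext => u; rewrite /residual /stopped !indicE.
  have -> : (s \in `[0, xi u]%classic) = (u \in A).
    by rewrite mem_setE in_itv/= s0 /=; apply/idP/idP; rewrite inE.
  by rewrite /k; ring.
have ir := integrable_residual H_gt H_lt a2 xi_nd s.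
have ik : \int[P]_u k u = a s * p.
  rewrite kE (RintegralD measurableT ir iA).
  rewrite -[X in X + _]/(mean_residual H a xi s) V0 add0r.
  rewrite (@RintegralZl _ _ _ P setT (\1_A) (a s) measurableT
    (@integrable_indic _ _ _ P A mA)).
  congr (_ * _); rewrite /p /Rintegral (integral_indic P measurableT mA).
  by rewrite setIT.
have iik : P.-integrable setT (fun u => (k u)%:E).
  rewrite kE; exact: (integrableD measurableT ir iA).
rewrite /cond_expectation -/A -/p unlock.
have -> : (\int[P]_w (((fun u => fbm_kernel H (xi u) s) \* \1_A)%R w)%:E =
    (a s * p)%:E)%E.
  rewrite -ik; transitivity (\int[P]_u (k u)%:E)%E.
    apply: eq_integral => u _; rewrite /= -/(k u) indicE.
    have [uA|uA] := boolP (u \in A); first by rewrite mulr1.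
    rewrite mulr0 /k fbm_kernel_out//; apply: contra uA => /andP[_ /ltW su].
    by rewrite inE.
  by apply: esym; exact: (fineK (integrable_fin_num measurableT iik)).
by rewrite -EFinM mulfK// gt_eqF.
Qed.

End conclusion.

Theorem theorem4 (R : realType) (H : R) (a : R -> R)
    (H_gt : 2^-1 < H) (H_lt : H < 1) (a_min : fbm_minimizer H a) :
  exists (d : measure_display) (T : measurableType d) (P : probability T R)
         (xi : {RV P >-> R}),
    (forall w : T, fbm_G H a (xi w)) /\
    (forall s : R, 0 <= s < 1 -> (0 < P [set w | (s <= xi w)%R])%E) /\
    {ae lebesgue_measure, forall s : R, s \in `[0, 1] ->
       (a s)%:E =
       cond_expectation P (fun w => fbm_kernel H (xi w) s)
                          [set w | (s <= xi w)%R]}.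
Proof.
have [min_energy [Fmax Fmin FG]] := minimizerP H_gt H_lt a_min.
set a0 := a \_ `[0, 1] in Fmax Fmin FG.
have a02 : a0 \in Lfun (uniform_prob (@ltr01 R)) 2%:E by exact: L2_01_patch a_min.1.
have a0E s : s \in `[0, 1] -> a s = a0 s.
  by move=> s01; rewrite /a0 patchE mem_setE s01.
have a0out s : s \notin `[0, 1] -> a0 s = 0.
  by move=> s01; rewrite /a0 patchE mem_setE (negbTE s01).
have [xi [xi_nd xi_act xi_tail xi_mean]] : exists xi : R -> R,
    [/\ {homo xi : u v / u <= v}, forall u, active H a0 min_energy (xi u),
        forall s, s < 1 -> (0 < uniform_prob (@ltr01 R) [set u | (s <= xi u)%R])%E &
        {ae uniform_prob (@ltr01 R), forall s, mean_residual H a0 xi s = 0}].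
  have : 0 <= min_energy.
    apply: le_trans (Fmax 0 _); first exact: dot_ge0.
    by rewrite in_itv/= lexx ler01.
  rewrite le_eqVlt => /predU1P[min0|min0].
    (* the energy at time 1 is 0, so [a] is [K(1,.)] almost everywhere *)
    have one01 : 1 \in `[(0:R), 1] by rewrite in_itv/= lexx ler01.
    have e1 : energy H a0 1 = 0.
      by apply/eqP; rewrite eq_le dot_ge0 andbT min0 Fmax.
    exists (cst 1); split => //.
    - by move=> u; split => //; rewrite e1.
    - move=> s s1; rewrite (_ : [set u | _] = setT); last first.
        by apply/seteqP; split => u //= _; exact: ltW.
      by rewrite probability_setT.
    - have := dot_eq0 (residual_L2 H_gt H_lt 1 a02) e1.
      apply: (@filterS _ _ (@ae_filter_ringOfSetsType _ _ _
        (uniform_prob (@ltr01 R)))) => s rs.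
      exact: etrans (Rintegral_uniform_cst (residual H a0 1 s)) rs.
  have [xi [xi_nd xi_act] xi_stat] := stationarity H_gt H_lt a02 Fmax Fmin.
  exists xi; split => //.
  - move=> s; exact: (active_tail_gt0 H_gt H_lt a02 a0out Fmax min0
      xi_nd xi_act xi_stat).
  - exact: (mean_residual_eq0 H_gt H_lt a02 xi_nd xi_stat).
have mxi : measurable_fun setT (xi : measurableTypeR R -> R).
  exact: nondecreasing_measurable.
pose X : {RV (uniform_prob (@ltr01 R)) >-> R} :=
  HB.pack (xi : measurableTypeR R -> R) (isMeasurableFun.Build _ _ _ _ _ mxi).
exists _, _, (uniform_prob (@ltr01 R)), X; split => [u|].
  by have [u01 ue] := xi_act u; exact: FG.
split => [s /andP[_ s1]|]; first exact: xi_tail.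
have := ae_uniform01 xi_mean.
apply: (@filterS _ _ (@ae_filter_ringOfSetsType _ _ _ (@lebesgue_measure R))).
move=> s + s01 => /(_ s01) [s1 ms].
rewrite a0E//; apply: conditional_mean => //.
- by move: s01; rewrite in_itv/= => /andP[].
- exact: xi_tail.
Qed.
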